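(* For infinite time Turing machines, $\mathrm{P}\neq\mathrm{NP}\cap\mathrm{co}\text{-}\mathrm{NP}$; in particular $\mathrm{P}\neq\mathrm{NP}$.
   Context: $\mathbb{R}=2^\omega$. Infinite time Turing machines (ITTMs): three binary tapes indexed by $\omega$, finite program with start, limit, halt states; ordinary Turing operation at successor stages; at limit stages the limit state is entered, the head returns to the leftmost cell, and each cell takes the $\limsup$ of its earlier values. A set $A\subseteq\mathbb{R}$ is in $\mathrm{P}$ if there are a program $p$ and $n\in\omega$ such that $p$ decides $A$ and halts on every input in fewer than $\omega^n$ steps. $A$ is in $\mathrm{NP}$ if there are a program $p$ and $n\in\omega$ such that $p$ halts on every input pair $(x,y)$ in fewer than $\omega^n$ steps and $x\in A$ iff there exists $y\in\mathbb{R}$ such that $p$ accepts $(x,y)$. $\mathrm{co}\text{-}\mathrm{NP}$ is the class of complements $\mathbb{R}\setminus A$ of sets $A\in\mathrm{NP}$. *)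

(* Defs.v *)
(* infinite time Turing machines, with time
   stages below omega^omega represented as lexicographically ordered
   tuples of naturals (Cantor normal form, most significant first). *)
From HB Require Import structures.
From mathcomp Require Import all_boot.
Set Implicit Arguments. Unset Strict Implicit. Unset Printing Implicit Defensive.

Definition real := nat -> bool.

Definition pairR (x y : real) : real :=
  fun k => if odd k then y k./2 else x k./2.

(* An ITTM program: finitely many states (a finType), distinguished start,
   limit and halt states, and a transition function reading the three
   cells under the head and returning new state, three written bits and a
   move (true = right, false = left). *)
Record Prog := {
  St : finType;
  start_st : St;
  limit_st : St;
  halt_st : St;
  delta : St -> bool * bool * bool -> St * (bool * bool * bool) * bool
}.

Record Config (p : Prog) := {
  cst : St p;
  chead : nat;
  tape1 : real;   (* input tape *)
  tape2 : real;   (* scratch tape *)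
  tape3 : real    (* output tape *)
}.

Definition upd (t : real) (h : nat) (b : bool) : real :=
  fun k => if k == h then b else t k.

(* One ordinary Turing step; a halted machine stays put. Moving left from
   cell 0 leaves the head at cell 0. *)
Definition step (p : Prog) (c : Config p) : Config p :=
  if cst c == halt_st p then c else
  let h := chead c in
  let: (q', (w1, w2, w3), mv) := delta (cst c) (tape1 c h, tape2 c h, tape3 c h) in
  {| cst := q'; chead := if mv then h.+1 else h.-1;
     tape1 := upd (tape1 c) h w1; tape2 := upd (tape2 c) h w2;
     tape3 := upd (tape3 c) h w3 |}.

Definition init (p : Prog) (x : real) : Config p :=
  {| cst := start_st p; chead := 0; tape1 := x;
     tape2 := fun _ => false; tape3 := fun _ => false |}.

(* Ordinals below omega^n: sequences of length n, s = [c_{n-1}; ...; c_0]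
   standing for omega^(n-1) c_{n-1} + ... + c_0, compared lexicographically. *)
Fixpoint lexlt (s t : seq nat) : bool :=
  match s, t with
  | a :: s', b :: t' => (a < b) || ((a == b) && lexlt s' t')
  | _, _ => false
  end.

Definition lexle (s t : seq nat) : bool := (s == t) || lexlt s t.

Definition is_zero (s : seq nat) : bool := all (fun a => a == 0) s.

(* successor: increment the last (omega^0) coefficient *)
Fixpoint incr_last (s : seq nat) : seq nat :=
  match s with
  | [::] => [::]
  | [:: a] => [:: a.+1]
  | a :: s' => a :: incr_last s'
  end.

Definition is_limit (s : seq nat) : bool := ~~ is_zero s && (last 0 s == 0).

Definition limsup_before (n : nat) (f : seq nat -> bool) (a : seq nat) : Prop :=
  forall b, size b = n -> lexlt b a ->
    exists g, [/\ size g = n, lexle b g, lexlt g a & f g = true].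

Definition run (p : Prog) (x : real) (n : nat) (r : seq nat -> Config p) : Prop :=
  [/\ forall a, size a = n -> is_zero a -> r a = init p x,
      forall a, size a = n -> 0 < n -> r (incr_last a) = step (r a)
    & forall a, size a = n -> is_limit a ->
        [/\ cst (r a) = limit_st p, chead (r a) = 0
          & forall k,
            (tape1 (r a) k = true <-> limsup_before n (fun g => tape1 (r g) k) a) /\
            (tape2 (r a) k = true <-> limsup_before n (fun g => tape2 (r g) k) a) /\
            (tape3 (r a) k = true <-> limsup_before n (fun g => tape3 (r g) k) a)]].

Arguments run : clear implicits.
Arguments init : clear implicits.

Definition HaltsWith (p : Prog) (n : nat) (x : real) (b : bool) : Prop :=
  exists r, run p x n r /\
    exists a, [/\ size a = n, cst (r a) = halt_st p,
                  (forall g, size g = n -> lexlt g a -> cst (r g) <> halt_st p)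
                & tape3 (r a) 0 = b].

Definition inP (A : real -> Prop) : Prop :=
  exists (p : Prog) (n : nat), forall x, exists b, HaltsWith p n x b /\ (b = true <-> A x).

Definition inNP (A : real -> Prop) : Prop :=
  exists (p : Prog) (n : nat),
    (forall x y, exists b, HaltsWith p n (pairR x y) b) /\
    (forall x, A x <-> exists y, HaltsWith p n (pairR x y) true).

Definition incoNP (A : real -> Prop) : Prop :=
  exists B, inNP B /\ forall x, A x <-> ~ B x.

(* Main.v *)
(** The separating set is the set of reals [e] coding an infinitary NOR circuit
    whose root gate outputs [true]. A real codes which gates are wired to which,
    and a row of bits per gate; a wire counts only if it descends in a
    lexicographic order of these rows that is well-founded for every [e] and has
    the order types of all ordinals below omega^omega. Hence every circuit has
    exactly one consistent valuation of its gates, and "the root is [true]" and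
    "the root is [false]" are complementary and both witnessed by that valuation.

    Whether a given valuation [y] is consistent is a "for all, there is"
    condition on [(e, y)]. A counter machine searches for the witnesses one after
    the other and flashes output cell 0 after each success; by the limsup rule
    the cell shows [true] at time omega iff all witnesses were found, so the
    verification takes omega + 1 steps.

    Conversely, the run of a program for omega^n steps is computed stage by
    stage by such a circuit. Wiring a copy of every bit of [e] into [e] itself at
    a later position yields, for each program, a circuit that outputs [true] iff
    the program rejects the code of that circuit. *)
Require Import Defs.
From HB Require Import structures.
From mathcomp Require Import all_boot.
From mathcomp Require Import boolp zify.
Set Implicit Arguments. Unset Strict Implicit. Unset Printing Implicit Defensive.

(** * Upper limits, pairing, causal recursion *)

Definition limsup (u : nat -> bool) : bool := `[< forall j, exists2 i, j <= i & u i >].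

Lemma limsupP (u : nat -> bool) : reflect (forall j, exists2 i, j <= i & u i) (limsup u).
Proof. exact: asboolP. Qed.

Lemma limsup_shift (n : nat) (u : nat -> bool) : limsup (fun j => u (n + j)) = limsup u.
Proof.
apply/limsupP/limsupP => inf_u j.
  by have [i ji ui] := inf_u j; exists (n + i); rewrite // (leq_trans ji) ?leq_addl.
have [i nji ui] := inf_u (n + j); have ni : n <= i by apply: leq_trans nji; apply: leq_addr.
by exists (i - n); [rewrite leq_subRL|rewrite subnKC].
Qed.

Lemma ltn_step_bracket (t : nat -> nat) (j : nat) :
  t 0 = 0 -> (forall m, t m < t m.+1) -> exists m, t m <= j < t m.+1.
Proof.
move=> t0 t_incr; elim: j => [|j [m /andP[mj jm]]].
  by exists 0; rewrite t0 -[X in X < _]t0 t_incr.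
have [jm1|jm1] := ltnP j.+1 (t m.+1); first by exists m; rewrite jm1 leqW.
by exists m.+1; rewrite jm1 (leq_ltn_trans jm).
Qed.

Definition cantor_pair (i j : nat) : nat := 'C((i + j).+1, 2) + j.

Lemma bin2S (n : nat) : 'C(n.+2, 2) = 'C(n.+1, 2) + n.+1.
Proof. by rewrite binS bin1. Qed.

Lemma cantor_pair_inj (i j i' j' : nat) :
  cantor_pair i j = cantor_pair i' j' -> i = i' /\ j = j'.
Proof.
have lt_diagonal n m : n < m -> 'C(n.+1, 2) + n < 'C(m.+1, 2).
  by move=> nm; rewrite -addnS -bin2S leq_bin2l.
rewrite /cantor_pair; case: (ltngtP (i + j) (i' + j')) => [/lt_diagonal|/lt_diagonal|E];
by rewrite ?E; lia.
Qed.

Lemma leq_cantor_pairl (i j : nat) : i <= cantor_pair i j.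
Proof. by rewrite /cantor_pair; case: i => // i; rewrite addSn bin2S; lia. Qed.

Lemma leq_cantor_pairr (i j : nat) : j <= cantor_pair i j.
Proof. exact: leq_addl. Qed.

Lemma causal_fixpoint (T : Type) (x0 : T) (F : (nat -> T) -> nat -> T) :
  (forall e e' k, (forall j, j < k -> e j = e' j) -> F e k = F e' k) ->
  exists e, forall k, e k = F e k.
Proof.
move=> causal; pose approx m := iter m F (fun=> x0).
have stable m m' j : j < m -> j < m' -> approx m j = approx m' j.
  elim/ltn_ind: j m m' => j IH [|m] [|m'] // jm jm'; apply: causal => i ij.
  by apply: IH => //; apply: leq_trans ij _.
by exists (fun k => approx k.+1 k) => k; apply: causal => j jk; apply: stable.
Qed.

(** * Stages *)

Lemma lexlt_wf (n : nat) : well_founded (fun a b : n.-tuple nat => lexlt a b).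
Proof.
elim: n => [|n IHn] a; first by constructor=> b; rewrite (tuple0 a) (tuple0 b).
case/tupleP: a => x s; elim/ltn_ind: x s => x IHx s.
elim/(well_founded_ind IHn): s => s IHs; constructor=> b; case/tupleP: b => y t.
by case/orP => [/IHx|/andP[/eqP -> /IHs]].
Qed.

Lemma lexlt_total (n : nat) (a b : n.-tuple nat) : [\/ lexlt a b, a = b | lexlt b a].
Proof.
have trichotomy (s t : seq nat) : size s = size t -> [\/ lexlt s t, s = t | lexlt t s].
  elim: s t => [|x s IH] [|y t] //=; first by constructor 2.
  case: (ltngtP x y) => [||->]; [by constructor 1|by constructor 3|].
  by case=> /IH[|->|]; [constructor 1|constructor 2|constructor 3].
case: (trichotomy a b); rewrite ?size_tuple //; [by constructor 1| |by constructor 3].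
by move/val_inj; constructor 2.
Qed.

Lemma incr_last_rcons (s : seq nat) (k : nat) : incr_last (rcons s k) = rcons s k.+1.
Proof. by elim: s => [|x [|y s] IH] //; congr cons; apply: IH. Qed.

Lemma lexlt_rcons (s t : seq nat) (x y : nat) : size s = size t ->
  lexlt (rcons s x) (rcons t y) = lexlt s t || (s == t) && (x < y).
Proof.
elim: s t => [|u s IH] [|v t] //=; first by rewrite andbF orbF.
by move=> [/IH ->]; rewrite eqseq_cons; case: ltngtP.
Qed.

Lemma lexlt_incr_last (s : seq nat) : s != [::] -> lexlt s (incr_last s).
Proof.
by case/lastP: s => // s k _; rewrite incr_last_rcons lexlt_rcons // eqxx ltnSn orbT.
Qed.

Variant stage_spec (n : nat) (a : n.-tuple nat) : bool -> bool -> Prop :=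
| ZeroStage of is_zero a : stage_spec a true false
| LimitStage of is_limit a : stage_spec a false true
| SuccStage (b : n.-tuple nat) of a = incr_last b :> seq nat & lexlt b a :
    stage_spec a false false.

Lemma stageP (n : nat) (a : n.-tuple nat) : stage_spec a (is_zero a) (is_limit a).
Proof.
have [a0|a_neq0] := boolP (is_zero a); first by rewrite /is_limit a0; constructor.
have [a_lim|] := boolP (is_limit a); first by constructor.
rewrite /is_limit a_neq0 /=; case: a a_neq0 => a.
case/lastP: a => [//|s [|k]] sz nz /=; rewrite ?last_rcons //.
have sz' : size (rcons s k) == n by rewrite -(eqP sz) !size_rcons.
move=> _; apply: (@SuccStage _ _ (Tuple sz')); rewrite /= ?incr_last_rcons //.
by rewrite -incr_last_rcons lexlt_incr_last // -size_eq0 size_rcons.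
Qed.

(** * Runs *)

Definition tape (p : Prog) (c : Config p) (i : nat) : real :=
  match i with 0 => tape1 c | 1 => tape2 c | _ => tape3 c end.

Lemma config_ext (p : Prog) (c c' : Config p) : cst c = cst c' -> chead c = chead c' ->
  (forall i k, tape c i k = tape c' i k) -> c = c'.
Proof.
case: c c' => q h t1 t2 t3 [q' h' t1' t2' t3'] /= -> -> tE.
by congr Build_Config; apply: funext; [apply: (tE 0)|apply: (tE 1)|apply: (tE 2)].
Qed.

Lemma limsup_beforeP (n : nat) (f : seq nat -> bool) (a : seq nat) :
  limsup_before n f a <->
  forall b : n.-tuple nat, lexlt b a -> exists g : n.-tuple nat, [/\ lexle b g, lexlt g a & f g].
Proof.
split=> [sup b ba|sup b sb ba].
  have [g [/eqP sg bg ga fg]] := sup b (size_tuple b) ba.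
  by exists (Tuple sg).
have [g [bg ga fg]] := sup (Tuple (introT eqP sb)) ba.
by exists g; rewrite size_tuple.
Qed.

Section Run.
Variables (p : Prog) (x : real) (n : nat).
Implicit Types (a b : n.-tuple nat) (r : seq nat -> Config p).

Lemma run_limit r a : run p x n r -> is_limit a ->
  [/\ cst (r a) = limit_st p, chead (r a) = 0 &
      forall i k, tape (r a) i k <-> limsup_before n (fun g => tape (r g) i k) a].
Proof.
move=> [_ _ r_lim] /(r_lim _ (size_tuple a))[-> -> tE]; split=> // i k.
by have [? []] := tE k; case: i => [|[]].
Qed.

Lemma run_incr_last r a b : run p x n r -> lexlt b a -> a = incr_last b :> seq nat ->
  r a = step (r b).
Proof.
move=> [_ r_succ _] ba ->; apply: r_succ; first exact: size_tuple.
by case: n a b ba => // a b; rewrite (tuple0 a) (tuple0 b).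
Qed.

Lemma run_unique r r' : run p x n r -> run p x n r' -> forall a, r a = r' a.
Proof.
move=> R R'; elim/(well_founded_ind (lexlt_wf (n := n))) => a IH.
case: (stageP a) => [a0|a_lim|b aE ba].
- have [r0 _ _] := R; have [r0' _ _] := R'.
  by rewrite r0 ?size_tuple // r0' ?size_tuple.
- have [q h tE] := run_limit R a_lim; have [q' h' tE'] := run_limit R' a_lim.
  apply: config_ext => [||i k]; [by rewrite q q'|by rewrite h h'|].
  apply/idP/idP => [/tE|/tE'] /limsup_beforeP sup; [apply/tE'|apply/tE];
  apply/limsup_beforeP => b /sup[g [bg ga]]; exists g; split=> //;
  by [rewrite -IH|rewrite IH].
- by rewrite (run_incr_last R ba aE) (run_incr_last R' ba aE) IH.
Qed.

Definition halts_at r a : Prop :=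
  cst (r a) = halt_st p /\ forall g : n.-tuple nat, lexlt g a -> cst (r g) <> halt_st p.

Lemma HaltsWithP r v : run p x n r ->
  HaltsWith p n x v <-> exists2 a, halts_at r a & tape3 (r a) 0 = v.
Proof.
move=> R; split=> [[r' [R' [a [/eqP sa]]]]|[a [a_halt first] <-]].
  have rE := run_unique R R'; rewrite -[a]/(tval (Tuple sa)) -rE => a_halt first <-.
  by exists (Tuple sa) => //; split=> // g ga; rewrite rE; apply: first; rewrite ?size_tuple.
exists r; split=> //; exists a; split; rewrite ?size_tuple // => g /eqP sg.
exact: first (Tuple sg).
Qed.

Lemma HaltsWith_unique v v' : HaltsWith p n x v -> HaltsWith p n x v' -> v = v'.
Proof.
move=> /[dup] -[r [R _]] /(HaltsWithP _ R)[a [a_halt a_first] <-].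
case/(HaltsWithP _ R)=> [a' [a'_halt a'_first] <-].
by case: (lexlt_total a a') => [/a'_first|->|/a_first].
Qed.

End Run.

(** * Runs of length omega *)

Section OmegaRun.
Variables (p : Prog) (x : real).

Definition omega_limit (c : Config p) : Config p :=
  {| cst := limit_st p; chead := 0;
     tape1 := fun k => limsup (fun j => tape1 (iter j (@step p) c) k);
     tape2 := fun k => limsup (fun j => tape2 (iter j (@step p) c) k);
     tape3 := fun k => limsup (fun j => tape3 (iter j (@step p) c) k) |}.

Definition omega2_run (a : seq nat) : Config p :=
  iter (nth 0 a 1) (@step p) (iter (nth 0 a 0) omega_limit (init p x)).

Lemma lexlt2 (a b c d : nat) : lexlt [:: a; b] [:: c; d] = (a < c) || (a == c) && (b < d).
Proof. by rewrite /= andbF orbF. Qed.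

Lemma lexle2 (a b c d : nat) : lexle [:: a; b] [:: c; d] = (a < c) || (a == c) && (b <= d).
Proof. by rewrite /lexle lexlt2 !eqseq_cons andbT; lia. Qed.

Lemma limsup_before_omega (f : seq nat -> bool) (i : nat) :
  limsup (fun j => f [:: i; j]) <-> limsup_before 2 f [:: i.+1; 0].
Proof.
split=> [/limsupP inf_f [|b0 [|b1 [|? ?]]] // _|sup].
  rewrite lexlt2 => bi; have [j b1j fj] := inf_f b1; exists [:: i; j].
  by rewrite lexle2 lexlt2; split=> //; lia.
apply/limsupP => j; have [||[|g0 [|g1 [|? ?]]] [// _]] := sup [:: i; j] => //.
  by rewrite lexlt2; lia.
rewrite lexle2 lexlt2 => jg gi; have -> : g0 = i by lia.
by exists g1 => //; lia.
Qed.

Lemma run_omega2 : run p x 2 omega2_run.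
Proof.
split.
- by case=> [|a [|b [|? ?]]] //= _ /andP[/eqP -> /andP[/eqP -> _]].
- by case=> [|a [|b [|? ?]]].
- case=> [|a [|b [|? ?]]] //= _; rewrite /is_limit /= andbT => /andP[nz /eqP b0].
  move: nz; rewrite b0 andbT; case: a => // a _; split=> // k.
  by split; [|split]; apply: (limsup_before_omega (fun s => _ (omega2_run s) k)).
Qed.

Lemma HaltsWith_after_omega :
  (forall j, cst (iter j (@step p) (init p x)) <> halt_st p) -> limit_st p <> halt_st p ->
  let c := step (omega_limit (init p x)) in cst c = halt_st p -> HaltsWith p 2 x (tape3 c 0).
Proof.
move=> no_halt lim_halt c c_halt; exists omega2_run; split; first exact: run_omega2.
exists [:: 1; 1]; split=> // -[|[|a] [|b [|? ?]]] // _; rewrite lexlt2 => ab.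
  exact: no_halt.
by have [-> ->] : a = 0 /\ b = 0 by lia.
Qed.

End OmegaRun.

Inductive steps (p : Prog) : nat -> bool -> Config p -> Config p -> Prop :=
| Steps0 c : steps 0 false c c
| StepsS m f c c' : cst c != halt_st p -> steps m f (step c) c' ->
    steps m.+1 (tape3 c 0 || f) c c'.

Section Steps.
Variable p : Prog.
Implicit Types (c : Config p) (f : bool).

Lemma steps_trans m1 m2 f1 f2 c1 c2 c3 :
  steps m1 f1 c1 c2 -> steps m2 f2 c2 c3 -> steps (m1 + m2) (f1 || f2) c1 c3.
Proof.
by elim=> // m f c c' nh _ IH /IH c'c3; rewrite addSn -orbA; apply: StepsS.
Qed.

Lemma stepsP m f c c' : steps m f c c' ->
  [/\ iter m (@step p) c = c',
      forall j, j < m -> cst (iter j (@step p) c) <> halt_st p &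
      f <-> exists2 j, j < m & tape3 (iter j (@step p) c) 0].
Proof.
elim=> {m f c c'} [c|m f c c' nh _ [end_c' no_halt flag]]; first by split=> //; split=> // -[].
split; first by rewrite iterSr.
  by case=> [_|j jm]; [apply/eqP|rewrite iterSr; apply: no_halt].
split=> [/orP[c0|/flag[j jm j_flag]]|[[|j] jm j_flag]].
- by exists 0.
- by exists j.+1; rewrite // iterSr.
- exact/orP/or_introl.
- by apply/orP/or_intror/flag; exists j; rewrite -?iterSr.
Qed.

Lemma limsup_milestones (c : nat -> Config p) (f : nat -> bool) :
  (forall m, exists k, 0 < k /\ steps k (f m) (c m) (c m.+1)) ->
  (forall j, cst (iter j (@step p) (c 0)) <> halt_st p) /\
  limsup (fun j => tape3 (iter j (@step p) (c 0)) 0) = limsup f.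
Proof.
move=> /choice[k k_seg]; pose t m := \sum_(i < m) k i.
have tS m : t m.+1 = t m + k m by rewrite /t big_ord_recr.
have t_incr m : t m < t m.+1 by rewrite tS -[X in X < _]addn0 ltn_add2l; have [] := k_seg m.
have leq_t : {homo t : m m' / m <= m'}.
  by apply: homo_leq leqnn leq_trans _ => m; apply: ltnW.
have t_ge m : m <= t m by elim: m => // m IH; apply: leq_ltn_trans (t_incr m).
have iter_t m : iter (t m) (@step p) (c 0) = c m.
  elim: m => [|m IH]; first by rewrite /t big_ord0.
  by have [_ /stepsP[<- _ _]] := k_seg m; rewrite tS addnC iterD IH.
have iter_from m j : t m <= j -> iter j (@step p) (c 0) = iter (j - t m) (@step p) (c m).
  by move=> tj; rewrite -(iter_t m) -iterD subnK.
have bracket j : exists m, t m <= j < t m.+1 by apply: ltn_step_bracket; rewrite // /t big_ord0.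
split=> [j|].
  have [m /andP[mj jm]] := bracket j; have [_ /stepsP[_ no_halt _]] := k_seg m.
  by rewrite (iter_from m) //; apply: no_halt; move: jm; rewrite tS; lia.
apply/limsupP/limsupP => inf j.
  have [i ti i_flag] := inf (t j); have [m /andP[mi im]] := bracket i; exists m.
    by rewrite leqNgt; apply/negP => /leq_t; lia.
  have [_ /stepsP[_ _ flag]] := k_seg m; apply/flag; exists (i - t m).
    by move: im; rewrite tS; lia.
  by rewrite -iter_from.
have [m jm /[dup] fm] := inf j; have [_ /stepsP[_ _ flag]] := k_seg m.
case/flag=> i _ i_flag; exists (t m + i); first by have := t_ge m; lia.
by rewrite (iter_from m) ?leq_addr // addKn.
Qed.

End Steps.

(** * Counter programs on an infinite time Turing machine *)

(* The tapes are cut into blocks. Register [i], with [4 <= i < block], holds [a]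
   when tape 2 carries a mark in cell [block * a + i]; the first four cells of
   block [a] of tape 1 are the input bits that can be queried at address [a].
   Tape 3 has a mark in cell 1, by which the head finds its way back, and cell 0
   of tape 3 is raised for one step by a flash. *)
Notation block := 20 (only parsing).

Definition is_reg (i : nat) : bool := 4 <= i < block.

Definition memory := nat -> nat.
Definition store (s : memory) (i v : nat) : memory := fun j => if j == i then v else s j.

Lemma store_id (s : memory) (i : nat) : store s i (s i) = s.
Proof. by apply: funext => j; rewrite /store; case: eqP => // ->. Qed.

Lemma upd_id (t : real) (h : nat) : upd t h (t h) = t.
Proof. by apply: funext => k; rewrite /upd; case: eqP => // ->. Qed.

Definition marks (s : memory) : real :=
  fun k => (4 <= k %% block) && (s (k %% block) == k %/ block).
Definition endmark : real := fun k => k == 1.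

Lemma mod_block (a i : nat) : i < block -> (block * a + i) %% block = i.
Proof. lia. Qed.

Lemma div_block (a i : nat) : i < block -> (block * a + i) %/ block = a.
Proof. lia. Qed.

Lemma marks_at (s : memory) (i : nat) : is_reg i -> marks s (block * s i + i).
Proof. by case/andP=> i4 ib; rewrite /marks mod_block // div_block // i4 eqxx. Qed.

Lemma marks_set (s : memory) (i v : nat) : is_reg i ->
  upd (upd (marks s) (block * s i + i) false) (block * v + i) true = marks (store s i v).
Proof.
case/andP=> i4 ib; apply: funext => k; rewrite /upd /marks /store.
have [->|kv] := eqVneq k (block * v + i); first by rewrite mod_block // div_block // i4 !eqxx.
have [ki|ki] := eqVneq (k %% block) i; last first.
  by case: eqP => // ks; case/eqP: ki; rewrite ks mod_block.
have kE := divn_eq k block; rewrite ki mulnC in kE.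
have -> : (v == k %/ block) = false by apply: contraNF kv => /eqP ->; rewrite -kE.
rewrite andbF; case: eqP => // ks; apply/negbTE; apply: contra_notN ks => /andP[_ /eqP sE].
by rewrite -ki sE mulnC -divn_eq.
Qed.

Inductive test :=
| TZero of nat
| TQuery of nat & nat.

Definition test_reg (t : test) : nat := match t with TZero i | TQuery _ i => i end.

Definition test_ok (t : test) : bool :=
  match t with TZero i => is_reg i | TQuery o i => (o < 4) && is_reg i end.

Definition holds (x : real) (t : test) (s : memory) : bool :=
  match t with TZero i => s i == 0 | TQuery o i => x (block * s i + o) end.

Inductive instr :=
| IInc of nat & nat
| IDec of nat & nat
| IBranch of test & nat & nat
| IFlash of nat.

Definition ijump (l : nat) : instr := IBranch (TZero 4) l l.

Definition instr_ok (I : instr) : bool :=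
  match I with
  | IInc i _ | IDec i _ => is_reg i
  | IBranch t _ _ => test_ok t
  | IFlash _ => true
  end.

Definition effect (x : real) (I : instr) (s : memory) : nat * memory :=
  match I with
  | IInc i l => (l, store s i (s i).+1)
  | IDec i l => (l, store s i (s i).-1)
  | IBranch t l1 l0 => (if holds x t s then l1 else l0, s)
  | IFlash l => (l, s)
  end.

Definition flashes (I : instr) : bool := if I is IFlash _ then true else false.

Section Machine.
Variable code : seq instr.
Local Notation label := 'I_(size code).+1.
Local Notation offset := 'I_block.

(* [Scan l r f] looks for the mark of the register of instruction [l] at offset
   [r] of a block, the first one if [f]. [Walk d k a] moves [k] cells, to the
   right if [d], and there sets a mark if [a = inl l], or tests the input if
   [a = inr (l1, l0)]. *)
Inductive mstate :=
| Setup of offset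
| Scan of label & offset & bool
| Walk of bool & offset & label + label * label
| Rewind of label
| Lower of label
| AtLimit
| Halted.

Definition mstate_code : finType :=
  (offset + label * offset * bool + bool * offset * (label + label * label)
   + label * bool + bool)%type.

Definition mstate_encode (q : mstate) : mstate_code :=
  match q with
  | Setup r => inl (inl (inl (inl r)))
  | Scan l r f => inl (inl (inl (inr (l, r, f))))
  | Walk d k a => inl (inl (inr (d, k, a)))
  | Rewind l => inl (inr (l, true))
  | Lower l => inl (inr (l, false))
  | AtLimit => inr true
  | Halted => inr false
  end.

Definition mstate_decode (c : mstate_code) : mstate :=
  match c with
  | inl (inl (inl (inl r))) => Setup r
  | inl (inl (inl (inr (l, r, f)))) => Scan l r f
  | inl (inl (inr (d, k, a))) => Walk d k a
  | inl (inr (l, true)) => Rewind l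
  | inl (inr (l, false)) => Lower l
  | inr true => AtLimit
  | inr false => Halted
  end.

Lemma mstate_encodeK : cancel mstate_encode mstate_decode.
Proof. by case. Qed.

HB.instance Definition _ := Finite.copy mstate (can_type mstate_encodeK).

Definition mdelta (q : mstate) (b : bool * bool * bool) : mstate * (bool * bool * bool) * bool :=
  let: (b1, b2, b3) := b in
  match q with
  | Setup r => (if r == 19 :> nat then Rewind ord0 else Setup (inord r.+1),
                (b1, 4 <= r, r == 1 :> nat), true)
  | Scan l r f =>
    let at_mark i action :=
      if (r == i :> nat) && b2 then action
      else (Scan l (inord (r.+1 %% block)) (f && (r.+1 < block)), b, true) in
    match nth (ijump 0) code l with
    | IInc i l' => at_mark i (Walk true (inord 19) (inl (inord l')), (b1, false, b3), true)
    | IDec i l' =>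
      at_mark i (if f then (Rewind (inord l'), b, false)
                 else (Walk false (inord 19) (inl (inord l')), (b1, false, b3), false))
    | IBranch (TZero i) l1 l0 => at_mark i (Rewind (inord (if f then l1 else l0)), b, false)
    | IBranch (TQuery o i) l1 l0 =>
      at_mark i (Walk false (inord (i - o.+1)) (inr (inord l1, inord l0)), b, false)
    | IFlash l' => (Lower (inord l'), (b1, b2, true), false)
    end
  | Walk d k a =>
    if k == 0 :> nat then
      match a with
      | inl l => (Rewind l, (b1, true, b3), false)
      | inr (l1, l0) => (Rewind (if b1 then l1 else l0), b, true)
      end
    else (Walk d (inord k.-1) a, b, d)
  | Rewind l => (if b3 then Scan l ord0 true else Rewind l, b, false)
  | Lower l => (Scan l ord0 true, (b1, b2, false), false)
  | AtLimit | Halted => (Halted, b, true)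
  end.

Definition machine : Prog :=
  {| St := mstate; start_st := Setup ord0; limit_st := AtLimit; halt_st := Halted;
     delta := mdelta |}.

Definition mcfg (q : mstate) (h : nat) (t1 t2 t3 : real) : Config machine :=
  @Build_Config machine q h t1 t2 t3.

Definition next_mcfg (q : mstate) (h : nat) (t1 t2 t3 : real) : Config machine :=
  let: (q', (w1, w2, w3), mv) := mdelta q (t1 h, t2 h, t3 h) in
  mcfg q' (if mv then h.+1 else h.-1) (upd t1 h w1) (upd t2 h w2) (upd t3 h w3).

Lemma steps_mcfg q h t1 t2 t3 c m f : q != Halted ->
  steps m f (next_mcfg q h t1 t2 t3) c -> steps m.+1 (t3 0 || f) (mcfg q h t1 t2 t3) c.
Proof.
move=> qH next; apply: (@StepsS _ _ _ (mcfg q h t1 t2 t3)) => //.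
by rewrite /step /= (negPf qH).
Qed.

Lemma steps_mcfg_quiet q h t1 t2 t3 c m f : q != Halted -> t3 0 = false ->
  steps m f (next_mcfg q h t1 t2 t3) c -> steps m.+1 f (mcfg q h t1 t2 t3) c.
Proof. by move=> qH t30 /(steps_mcfg qH); rewrite t30. Qed.

Definition reach (f : bool) (c c' : Config machine) : Prop := exists m, steps m f c c'.

Lemma reach_refl c : reach false c c.
Proof. by exists 0; apply: Steps0. Qed.

Lemma reach_trans f1 f2 c1 c2 c3 : reach f1 c1 c2 -> reach f2 c2 c3 -> reach (f1 || f2) c1 c3.
Proof. by move=> [m1 s1] [m2 s2]; exists (m1 + m2); apply: steps_trans s1 s2. Qed.

Lemma reach_step q h t1 t2 t3 c f : q != Halted -> t3 0 = false ->
  reach f (next_mcfg q h t1 t2 t3) c -> reach f (mcfg q h t1 t2 t3) c.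
Proof. by move=> qH t30 [m next]; exists m.+1; apply: steps_mcfg_quiet. Qed.

Definition cfg (x : real) (l : nat) (s : memory) : Config machine :=
  mcfg (Scan (inord l) ord0 true) 0 x (marks s) endmark.

Lemma reach_rewind h l x t2 : 0 < h ->
  reach false (mcfg (Rewind l) h x t2 endmark) (mcfg (Scan l ord0 true) 0 x t2 endmark).
Proof.
elim: h => // h IH _; apply: reach_step; rewrite // /next_mcfg /= !upd_id.
by case: h IH => [|h] IH; [apply: reach_refl|apply: IH].
Qed.

Lemma reach_walk d k a h x t2 : k < block -> d || (k <= h) ->
  reach false (mcfg (Walk d (inord k) a) h x t2 endmark)
    (mcfg (Walk d (inord 0) a) (if d then h + k else h - k) x t2 endmark).
Proof.
elim: k h => [|k IH] h kb kh; first by rewrite addn0 subn0 if_same; apply: reach_refl.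
apply: reach_step; rewrite // /next_mcfg /= inordK //= !upd_id.
have -> : (if d then h + k.+1 else h - k.+1) =
    if d then (if d then h.+1 else h.-1) + k else (if d then h.+1 else h.-1) - k.
  by case: (d) => /=; lia.
by apply: IH; [apply: ltnW|case: (d) kh => //= kh; lia].
Qed.

Definition instr_reg (I : instr) : nat :=
  match I with IInc i _ | IDec i _ => i | IBranch t _ _ => test_reg t | IFlash _ => 0 end.

Lemma instr_reg_ok I : instr_ok I -> ~~ flashes I -> is_reg (instr_reg I).
Proof. by case: I => [? ?|? ?|[?|? ?] ? ?|?] //= /andP[]. Qed.

Section Instr.
Variables (x : real) (l : nat) (s : memory).
Hypothesis l_code : l <= size code.
Local Notation I := (nth (ijump 0) code l).
Local Notation i := (instr_reg I).

Lemma mdelta_scan (r : offset) f b : ~~ flashes I -> ~~ ((r == i :> nat) && b.1.2) ->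
  mdelta (Scan (inord l) r f) b =
  (Scan (inord l) (inord (r.+1 %% block)) (f && (r.+1 < block)), b, true).
Proof.
case: b => [[b1 b2] b3] /=; rewrite inordK //.
by case: I => [j ?|j ?|[j|o j] ? ?|//] _ /= /negPf ->.
Qed.

Definition found : Config machine :=
  mcfg (Scan (inord l) (inord i) (s i == 0)) (block * s i + i) x (marks s) endmark.

Lemma steps_found : ~~ flashes I -> is_reg i -> steps (block * s i + i) false (cfg x l s) found.
Proof.
move=> nf /andP[i4 ib].
suff scan j : j <= block * s i + i -> steps j false (cfg x l s)
    (mcfg (Scan (inord l) (inord (j %% block)) (j < block)) j x (marks s) endmark).
  have := scan _ (leqnn _); rewrite mod_block //.
  by have -> : (block * s i + i < block) = (s i == 0) by lia.
elim: j => [|j IH] jle.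
  rewrite /cfg; have -> : ord0 = inord 0 :> offset by apply/val_inj; rewrite /= inordK.
  exact: Steps0.
rewrite -addn1 -[false]orbF; apply: steps_trans (IH (ltnW jle)) _; apply: steps_mcfg_quiet => //.
have jK : (inord (j %% block) : offset) = j %% block :> nat by rewrite inordK // ltn_mod.
rewrite /next_mcfg mdelta_scan // jK.
  rewrite !upd_id addn1.
  have -> : (j %% block).+1 %% block = j.+1 %% block by lia.
  have -> : (j < block) && ((j %% block).+1 < block) = (j.+1 < block) by lia.
  exact: Steps0.
apply/negP => /andP[/eqP ji] /=; rewrite /marks ji => /andP[_ /eqP sj].
by move: jle; rewrite sj; lia.
Qed.

Lemma reach_found c : instr_ok I -> ~~ flashes I ->
  reach false (next_mcfg (Scan (inord l) (inord i) (s i == 0)) (block * s i + i)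
                 x (marks s) endmark) c ->
  reach false found c.
Proof.
move=> ok nf; have /andP[i4 _] := instr_reg_ok ok nf.
by apply: reach_step => //; rewrite /endmark; lia.
Qed.

Lemma reach_found_inc r l' : I = IInc r l' -> is_reg r ->
  reach false found (cfg x l' (store s r (s r).+1)).
Proof.
move=> IE r_reg; have r_mark := marks_at s r_reg; apply: reach_found; rewrite IE //.
case/andP: (r_reg) => r4 rb; rewrite /next_mcfg /= inordK // IE inordK // eqxx r_mark /= !upd_id.
rewrite -[false]orbF; apply: reach_trans; first exact: reach_walk.
apply: reach_step => //; rewrite /next_mcfg /= inordK //= !upd_id.
have -> : (block * s r + r).+1 + 19 = block * (s r).+1 + r by lia.
by rewrite marks_set //; apply: reach_rewind; lia.
Qed.

Lemma reach_found_dec r l' : I = IDec r l' -> is_reg r ->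
  reach false found (cfg x l' (store s r (s r).-1)).
Proof.
move=> IE r_reg; have r_mark := marks_at s r_reg; apply: reach_found; rewrite IE //.
case/andP: (r_reg) => r4 rb; rewrite /next_mcfg /= inordK // IE inordK // eqxx r_mark /=.
case: eqP => [s0|s_neq0]; rewrite !upd_id.
  rewrite -{1}r_mark upd_id s0 -[X in store s r X]s0 store_id.
  by apply: reach_rewind; lia.
rewrite -[false]orbF; apply: reach_trans; first by apply: reach_walk => //=; lia.
apply: reach_step => //; rewrite /next_mcfg /= inordK //= !upd_id.
have -> : (block * s r + r).-1 - 19 = block * (s r).-1 + r by lia.
by rewrite marks_set //; apply: reach_rewind; lia.
Qed.

Lemma reach_found_branch t l1 l0 : I = IBranch t l1 l0 -> test_ok t ->
  reach false found (cfg x (if holds x t s then l1 else l0) s).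
Proof.
move=> IE t_ok; apply: reach_found; rewrite IE //.
case: t IE t_ok => [r|o r] /= IE => [r_reg|/andP[o4 r_reg]].
all: have r_mark := marks_at s r_reg; case/andP: (r_reg) => r4 rb.
all: rewrite /next_mcfg /= inordK // IE inordK // eqxx r_mark /= !upd_id -{1}r_mark upd_id.
  by apply: reach_rewind; lia.
rewrite -[false]orbF; apply: reach_trans; first by apply: reach_walk => /=; lia.
apply: reach_step => //; rewrite /next_mcfg /= inordK //= !upd_id.
have -> : (block * s r + r).-1 - (r - o.+1) = block * s r + o by lia.
by rewrite -fun_if; apply: reach_rewind.
Qed.

Lemma steps_instr : instr_ok I -> exists m,
  0 < m /\ steps m (flashes I) (cfg x l s) (cfg x (effect x I s).1 (effect x I s).2).
Proof.
move=> ok; have [fl|nf] := boolP (flashes I).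
  case IE: I fl => [|||l'] // _; exists 2; split=> //; apply: steps_mcfg_quiet => //.
  rewrite /next_mcfg /= inordK // IE !upd_id -[true]/(true || false); apply: steps_mcfg => //.
  rewrite /next_mcfg /= !upd_id; have -> : upd (upd endmark 0 true) 0 false = endmark.
    by apply: funext => -[].
  exact: Steps0.
have i_reg := instr_reg_ok ok nf.
have [m next] : reach false found (cfg x (effect x I s).1 (effect x I s).2).
  case IE: I ok nf => [r l'|r l'|t l1 l0|//] ok _.
  - exact: reach_found_inc IE ok.
  - exact: reach_found_dec IE ok.
  - exact: reach_found_branch IE ok.
exists (block * s i + i + m); split; first by case/andP: i_reg; lia.
by rewrite -[false]orbF; apply: steps_trans (steps_found nf i_reg) next.
Qed.

End Instr.

Lemma reach_instr x l s I : nth (ijump 0) code l = I -> l <= size code -> instr_ok I ->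
  reach (flashes I) (cfg x l s) (cfg x (effect x I s).1 (effect x I s).2).
Proof. by move=> <- l_code /(steps_instr x s l_code)[m [_ next]]; exists m. Qed.

Lemma reach_init x : reach false (init machine x) (cfg x 0 (fun=> 0)).
Proof.
pose t2 j : real := fun k => (k < j) && (4 <= k).
pose t3 j : real := fun k => (k < j) && (k == 1).
have setup j : j < block ->
    reach false (init machine x) (mcfg (Setup (inord j)) j x (t2 j) (t3 j)).
  elim: j => [_|j IH jb].
    have -> : inord 0 = ord0 :> offset by apply/val_inj; rewrite /= inordK.
    exact: reach_refl.
  rewrite -[false]orbF; apply: reach_trans (IH (ltnW jb)) _; apply: reach_step => //.
    exact: andbF.
  rewrite /next_mcfg /= inordK ?(ltnW jb) // ifN ?upd_id; last by lia.
  have -> : upd (t2 j) j (4 <= j) = t2 j.+1.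
    by apply: funext => k; rewrite /upd /t2; case: eqP => [->|]; lia.
  have -> : upd (t3 j) j (j == 1) = t3 j.+1.
    by apply: funext => k; rewrite /upd /t3; case: eqP => [->|]; lia.
  exact: reach_refl.
rewrite -[false]orbF; apply: reach_trans (setup 19 isT) _; apply: reach_step => //.
rewrite /next_mcfg /= inordK //= upd_id.
have -> : upd (t3 19) 19 false = endmark.
  by apply: funext => k; rewrite /upd /t3 /endmark; case: eqP; lia.
have -> : upd (t2 19) 19 true = marks (fun=> 0).
  by apply: funext => k; rewrite /upd /t2 /marks; case: eqP; lia.
rewrite /cfg; have -> : inord 0 = ord0 :> label by apply/val_inj; rewrite /= inordK.
exact: reach_rewind.
Qed.

End Machine.

(** * While programs *)

Inductive cmd :=
| CSkip
| CFlash
| CInc of nat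
| CDec of nat
| CSeq of cmd & cmd
| CIf of test & cmd & cmd
| CWhile of nat & cmd.

Fixpoint cmd_ok (c : cmd) : bool :=
  match c with
  | CSkip | CFlash => true
  | CInc i | CDec i => is_reg i
  | CSeq c1 c2 => cmd_ok c1 && cmd_ok c2
  | CIf t c1 c2 => [&& test_ok t, cmd_ok c1 & cmd_ok c2]
  | CWhile i c => is_reg i && cmd_ok c
  end.

Inductive exec (x : real) : cmd -> memory -> memory -> bool -> Prop :=
| ExecSkip s : exec x CSkip s s false
| ExecFlash s : exec x CFlash s s true
| ExecInc i s : exec x (CInc i) s (store s i (s i).+1) false
| ExecDec i s : exec x (CDec i) s (store s i (s i).-1) false
| ExecSeq c1 c2 s1 s2 s3 f1 f2 :
    exec x c1 s1 s2 f1 -> exec x c2 s2 s3 f2 -> exec x (CSeq c1 c2) s1 s3 (f1 || f2)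
| ExecIf t c1 c2 s s' f :
    exec x (if holds x t s then c1 else c2) s s' f -> exec x (CIf t c1 c2) s s' f
| ExecWhile0 i c s : s i = 0 -> exec x (CWhile i c) s s false
| ExecWhileS i c s1 s2 s3 f1 f2 : s1 i != 0 ->
    exec x c s1 s2 f1 -> exec x (CWhile i c) s2 s3 f2 -> exec x (CWhile i c) s1 s3 (f1 || f2).

Fixpoint compile (c : cmd) (l : nat) : seq instr :=
  match c with
  | CSkip => [::]
  | CFlash => [:: IFlash l.+1]
  | CInc i => [:: IInc i l.+1]
  | CDec i => [:: IDec i l.+1]
  | CSeq c1 c2 => let code1 := compile c1 l in code1 ++ compile c2 (l + size code1)
  | CIf t c1 c2 =>
    let code1 := compile c1 l.+1 in
    let l0 := (l.+1 + size code1).+1 in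
    let code2 := compile c2 l0 in
    IBranch t l.+1 l0 :: code1 ++ ijump (l0 + size code2) :: code2
  | CWhile i c =>
    let body := compile c l.+1 in
    IBranch (TZero i) (l.+1 + size body).+1 l.+1 :: body ++ [:: ijump l]
  end.

Section Compile.
Variable code : seq instr.

Definition placed (l : nat) (fragment : seq instr) : Prop :=
  exists pre post, code = pre ++ fragment ++ post /\ size pre = l.

Lemma placed_cat l code1 code2 :
  placed l (code1 ++ code2) -> placed l code1 /\ placed (l + size code1) code2.
Proof.
move=> [pre [post [codeE <-]]]; split.
  by exists pre, (code2 ++ post); rewrite codeE !catA.
by exists (pre ++ code1), post; rewrite codeE !catA size_cat.
Qed.

Lemma placed_cons l I code1 : placed l (I :: code1) -> placed l [:: I] /\ placed l.+1 code1.
Proof. by move/(@placed_cat _ [:: I]); rewrite addn1. Qed.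

Lemma reach_placed x l I s : placed l [:: I] -> instr_ok I ->
  reach (flashes I) (cfg code x l s) (cfg code x (effect x I s).1 (effect x I s).2).
Proof.
move=> [pre [post [codeE <-]]]; apply: reach_instr; rewrite codeE.
  by rewrite nth_cat ltnn subnn.
by rewrite size_cat leq_addr.
Qed.

Lemma reach_jump x l l' s : placed l [:: ijump l'] ->
  reach false (cfg code x l s) (cfg code x l' s).
Proof. by move=> /(reach_placed x s)/(_ isT); rewrite /= if_same. Qed.

Lemma reach_compile x c s s' f l : exec x c s s' f -> cmd_ok c -> placed l (compile c l) ->
  reach f (cfg code x l s) (cfg code x (l + size (compile c l)) s').
Proof.
move=> run_c; elim: run_c l => {c s s' f}
  [s|s|i s|i s|c1 c2 s1 s2 s3 f1 f2 _ IH1 _ IH2|t c1 c2 s s' f _ IH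
  |i c s si0|i c s1 s2 s3 f1 f2 si _ IH1 _ IH2] l /=.
- by rewrite addn0 => _ _; apply: reach_refl.
- by rewrite addn1 => _ here; apply: (reach_placed x s here).
- by rewrite addn1 => ok here; apply: (reach_placed x s here).
- by rewrite addn1 => ok here; apply: (reach_placed x s here).
- move=> /andP[ok1 ok2] /placed_cat[here1 here2].
  by rewrite size_cat addnA; apply: reach_trans (IH1 _ ok1 here1) (IH2 _ ok2 here2).
- move=> /and3P[t_ok ok1 ok2].
  set code1 := compile c1 _; set l0 := (_ + size code1).+1; set code2 := compile c2 _.
  move=> /placed_cons[here /placed_cat[here1 /placed_cons[here_jump here2]]].
  have -> : l + (size (code1 ++ ijump (l0 + size code2) :: code2)).+1 = l0 + size code2.
    by rewrite size_cat /= /l0; lia.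
  apply: (reach_trans (reach_placed x s here t_ok)) => /=.
  case: (holds x t s) IH => IH; last exact: IH.
  by rewrite -[f]orbF; apply: reach_trans (IH _ ok1 here1) (reach_jump x s' here_jump).
- move=> /andP[i_ok _] /placed_cons[here _]; rewrite size_cat addn1 -addSnnS addnS.
  by have := reach_placed x s here i_ok; rewrite /= si0.
- move=> /[dup] ok /andP[i_ok ok_c] /[dup] all_here /placed_cons[here].
  case/placed_cat=> here_body here_jump.
  apply: (reach_trans (reach_placed x s1 here i_ok)); rewrite /= (negPf si).
  apply: reach_trans (IH1 _ ok_c here_body) _; rewrite -[f2]/(false || f2).
  exact: reach_trans (reach_jump x s2 here_jump) (IH2 _ ok all_here).
Qed.

End Compile.

(* The label behind the code carries the default instruction, a jump back to 0. *)
Lemma steps_cycle x c s s' f : exec x c s s' f -> cmd_ok c -> exists m,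
  0 < m /\ steps m f (cfg (compile c 0) x 0 s) (cfg (compile c 0) x 0 s').
Proof.
move=> run_c ok; have [|m body] := reach_compile run_c ok (code := compile c 0) (l := 0).
  by exists [::], [::]; rewrite cats0.
have := @steps_instr (compile c 0) x (size (compile c 0)) s' (leqnn _).
rewrite nth_default //= if_same => /(_ isT)[m' [m'_gt0 jump]].
exists (m + m'); split; first by rewrite addn_gt0 m'_gt0 orbT.
by rewrite -[f]orbF; apply: steps_trans body jump.
Qed.

Definition loop_machine (c : cmd) : Prog := machine (compile c 0).

Lemma HaltsWith_loop x c (s : nat -> memory) (f : nat -> bool) : cmd_ok c ->
  s 0 = (fun=> 0) -> (forall m, exec x c (s m) (s m.+1) (f m)) ->
  HaltsWith (loop_machine c) 2 x (limsup f).
Proof.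
move=> ok s0 exec_s; set p := loop_machine c.
have [m /stepsP[setup setup_no_halt _]] := reach_init (compile c 0) x.
have [no_halt <-] := limsup_milestones (fun m => steps_cycle (exec_s m) ok).
have iter_setup j : iter (m + j) (@step p) (init p x) =
    iter j (@step p) (cfg (compile c 0) x 0 (s 0)).
  by rewrite addnC iterD setup s0.
have no_halt_init j : cst (iter j (@step p) (init p x)) <> halt_st p.
  by case: (ltnP j m) => [/setup_no_halt //|mj]; rewrite -(subnKC mj) iter_setup; apply: no_halt.
have <- : limsup (fun j => tape3 (iter (m + j) (@step p) (init p x)) 0) =
    limsup (fun j => tape3 (iter j (@step p) (cfg (compile c 0) x 0 (s 0))) 0).
  by congr limsup; apply: funext => j; rewrite iter_setup.
rewrite (limsup_shift m (fun j => tape3 (iter j (@step p) (init p x)) 0)).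
exact: HaltsWith_after_omega.
Qed.

(** * Infinitary NOR circuits *)

(* [wire x y]: gate [y] is an input of gate [x]. *)
Definition nor_valuation (T : Type) (wire : T -> T -> bool) (v : T -> bool) : Prop :=
  forall x, v x <-> forall y, wire x y -> ~~ v y.

Lemma nor_valuation_false (T : Type) (wire : T -> T -> bool) (v : T -> bool) (x y : T) :
  nor_valuation wire v -> wire x y -> v y -> v x = false.
Proof. by move=> nor_v xy vy; apply: contraTF vy => /nor_v; apply. Qed.

Lemma nor_valuation_exists (T : Type) (wire : T -> T -> bool) :
  well_founded (fun y x => wire x y) -> exists v, nor_valuation wire v.
Proof.
move=> wf; pose nor x (v : forall y, wire x y -> bool) :=
  `[< forall y (xy : wire x y), ~~ v y xy >].
exists (Fix wf (fun=> bool) nor) => x; rewrite Fix_eq.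
  by split=> /asboolP.
by move=> y v w vw; congr asbool; apply: eq_forall => z; apply: eq_forall => yz; rewrite vw.
Qed.

Lemma nor_valuation_unique (T : Type) (wire : T -> T -> bool) (v w : T -> bool) :
  well_founded (fun y x => wire x y) -> nor_valuation wire v -> nor_valuation wire w -> v =1 w.
Proof.
move=> wf nor_v nor_w; elim/(well_founded_ind wf) => x IH; apply/idP/idP.
  by move/nor_v => vx; apply/nor_w => y xy; rewrite -IH // vx.
by move/nor_w => wx; apply/nor_v => y xy; rewrite IH // wx.
Qed.

Lemma nor_valuation_comp (T U : Type) (num : U -> T) (wireT : T -> T -> bool)
    (wireU : U -> U -> bool) (v : T -> bool) :
  (forall u y, wireT (num u) y <-> exists2 w, y = num w & wireU u w) ->
  nor_valuation wireT v -> nor_valuation wireU (v \o num).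
Proof.
move=> wireE nor_v u; apply: (iff_trans (nor_v _)); split=> [vu w uw|vu y].
  by apply: vu; apply/wireE; exists w.
by move=> /wireE[w -> uw]; apply: vu.
Qed.

Definition true_input (T : Type) (wire : T -> T -> bool) (v : T -> bool) (x y : T) : bool :=
  v y && wire x y.

(* The equations of a valuation are equivalent to one existential statement per
   pair [xy]; [z] matters only if [xy.1] is false. *)
Definition nor_witness (T : Type) (wire : T -> T -> bool) (v : T -> bool) (xy : T * T) (z : T) :
    bool :=
  v xy.1 != true_input wire v xy.1 (if v xy.1 then xy.2 else z).

Lemma nor_witnessP (T : Type) (wire : T -> T -> bool) (v : T -> bool) :
  (forall xy, exists z, nor_witness wire v xy z) <-> nor_valuation wire v.
Proof.
rewrite /nor_witness /true_input; split=> [witness x|nor_v [x y] /=].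
  split=> [vx y xy|no_input].
    by have [z] := witness (x, y); rewrite /= vx xy andbT eq_sym eqb_id.
  have [z] := witness (x, x); case vx: (v x) => //=.
  by rewrite eq_sym eqbF_neg negbK => /andP[vz /no_input]; rewrite vz.
case vx: (v x).
  exists y; rewrite eq_sym eqb_id negb_and orbC -implybE; apply/implyP.
  exact: (nor_v x).1.
have : ~ (forall z, wire x z -> ~~ v z) by move/(nor_v x).2; rewrite vx.
by move/existsNP=> [z /not_implyP[xz /negP/negPn vz]]; exists z; rewrite vz xz.
Qed.

(** * A well-founded comparison of rows of bits *)

Definition drop_row (n : nat) (f : real) : real := fun t => f (n + t).

Lemma drop_rowS (n : nat) (f : real) : drop_row n.+1 f = drop_row 1 (drop_row n f).
Proof. by apply: funext => t; rewrite /drop_row addSnnS. Qed.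

(* Lexicographic comparison of two rows of bits, looking at [fuel] positions.
   The common prefix may contain at most as many zeros as it has leading ones:
   [h] is the remaining allowance, and [ph] records whether a zero has been met.
   Without this bound the order would not be well-founded. *)
Fixpoint row_lt (fuel : nat) (f g : real) (h : nat) (ph : bool) : bool :=
  if fuel is n.+1 then
    match f 0, g 0 with
    | true, true => row_lt n (drop_row 1 f) (drop_row 1 g) (if ph then h else h.+1) ph
    | true, false => false
    | false, true => true
    | false, false => if h is h'.+1 then row_lt n (drop_row 1 f) (drop_row 1 g) h' true else false
    end
  else false.

Definition leading_ones (f : real) (n : nat) : Prop := (forall s, s < n -> f s) /\ f n = false.

Lemma leading_ones_inj (f : real) (n m : nat) : leading_ones f n -> leading_ones f m -> n = m.
Proof. by move=> [n1 n0] [m1 m0]; case: (ltngtP n m) => // [/m1|/n1]; rewrite ?n0 ?m0. Qed.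

Definition lex_blocks (P : nat -> real -> real -> Prop) (f g : real) : Prop :=
  exists2 n, leading_ones f n &
    (forall s, s <= n -> g s) \/
    leading_ones g n /\ P n (drop_row n.+1 f) (drop_row n.+1 g).

Lemma lex_blocks_wf (P : nat -> real -> real -> Prop) :
  (forall n, well_founded (P n)) -> well_founded (lex_blocks P).
Proof.
move=> wfP; have acc_finite n f : leading_ones f n -> Acc (lex_blocks P) f.
  elim/ltn_ind: n f => n IHn f; move tail: (drop_row n.+1 f) => u.
  elim: (wfP n u) f tail => {}u _ IHu f tail fn; constructor=> g [m gm [f1|[fm below]]].
    by apply: IHn gm; rewrite ltnNge; apply/negP => /f1; rewrite fn.2.
  have mn := leading_ones_inj fm fn; subst m.
  by apply: (IHu (drop_row n.+1 g)) => //; rewrite -tail.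
by move=> f; constructor=> g [n /acc_finite].
Qed.

Lemma lex_blocks_cons1 (P : nat -> real -> real -> Prop) (f g : real) : f 0 -> g 0 ->
  lex_blocks (P \o succn) (drop_row 1 f) (drop_row 1 g) -> lex_blocks P f g.
Proof.
move=> f0 g0 [n [f1 fn] below]; exists n.+1; first by split=> // -[|s] // /f1.
case: below => [g1|[[g1 gn] below]]; first by left=> -[|s] // /g1.
by right; split=> //; split=> // -[|s] // /g1.
Qed.

Lemma lex_blocks_cons01 (P : nat -> real -> real -> Prop) (f g : real) :
  f 0 = false -> g 0 -> lex_blocks P f g.
Proof. by move=> f0 g0; exists 0; [|left=> -[]]. Qed.

Lemma lex_blocks_cons0 (P : nat -> real -> real -> Prop) (f g : real) :
  f 0 = false -> g 0 = false -> P 0 (drop_row 1 f) (drop_row 1 g) -> lex_blocks P f g.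
Proof. by move=> f0 g0 below; exists 0; [|right]. Qed.

Definition lex_nblocks (n : nat) : real -> real -> Prop :=
  iter n (fun P => lex_blocks (fun=> P)) (fun _ _ => False).

Lemma lex_nblocks_wf (n : nat) : well_founded (lex_nblocks n).
Proof. by elim: n => [f|n IH]; [constructor|apply: lex_blocks_wf]. Qed.

Lemma row_lt_tail (fuel : nat) (f g : real) (h : nat) :
  row_lt fuel f g h true -> lex_nblocks h.+1 f g.
Proof.
elim: fuel f g h => //= fuel IH f g h; case f0: (f 0); case g0: (g 0) => //.
- by move=> /IH; apply: (lex_blocks_cons1 (P := fun=> lex_nblocks h)).
- by move=> _; apply: lex_blocks_cons01.
- by case: h => // h /IH; apply: lex_blocks_cons0.
Qed.

Lemma row_lt_head (fuel : nat) (f g : real) (h : nat) :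
  row_lt fuel f g h false -> lex_blocks (fun n => lex_nblocks (h + n)) f g.
Proof.
elim: fuel f g h => //= fuel IH f g h; case f0: (f 0); case g0: (g 0) => //.
- move=> /IH; under [X in lex_blocks X]funext do rewrite addSnnS.
  exact: (lex_blocks_cons1 (P := fun n => lex_nblocks (h + n))).
- by move=> _; apply: lex_blocks_cons01.
- by case: h => // h /row_lt_tail below; apply: lex_blocks_cons0; rewrite // addn0.
Qed.

Lemma row_lt_wf : well_founded (fun f g => exists fuel, row_lt fuel f g 0 false).
Proof.
move=> f; elim: (lex_blocks_wf (fun n => lex_nblocks_wf (0 + n)) f) => {}f _ IH.
by constructor=> g [fuel /row_lt_head /IH].
Qed.

(** * Circuits coded by reals *)

Definition row (ranks : real) (N : nat) : real := fun t => ranks (cantor_pair N t).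

Definition descends (ranks : real) (N M : nat) : bool :=
  row_lt M (row ranks M) (row ranks N) 0 false.

Definition coded_wire (wires ranks : real) (N M : nat) : bool :=
  wires (cantor_pair N M) && descends ranks N M.

Lemma coded_wire_wf (wires ranks : real) : well_founded (fun M N => coded_wire wires ranks N M).
Proof.
move=> N; move rowE: (row ranks N) => f.
elim: (row_lt_wf f) N rowE => {}f _ IH N rowE; constructor=> M /andP[_ MN].
by apply: (IH (row ranks M)) => //; exists M; rewrite -rowE.
Qed.

Definition circuit (e : real) : nat -> nat -> bool :=
  coded_wire (fun a => e (10 * a)) (fun a => e (10 * a + 1)).

Definition outputs (b : bool) (e : real) : Prop :=
  exists2 v, nor_valuation (circuit e) v & v 0 = b.

Lemma outputs_trueP (e : real) : outputs true e <-> ~ outputs false e.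
Proof.
have wf : well_founded (fun M N => circuit e N M) by apply: coded_wire_wf.
split=> [[v nor_v v0] [w nor_w]|no_false].
  by rewrite -(nor_valuation_unique wf nor_v nor_w) v0.
have [v nor_v] := nor_valuation_exists wf; exists v => //.
by apply/negP => /negP/negPf v0; apply: no_false; exists v.
Qed.

(** * Dovetailing *)

Section Search.
Variable success : nat -> nat -> bool.

Definition search_next (sj : nat * nat) : nat * nat :=
  if success sj.1 sj.2 then (sj.1.+1, 0) else (sj.1, sj.2.+1).

Definition search (m : nat) : nat * nat := iter m search_next (0, 0).

Lemma searchS m : search m.+1 = search_next (search m).
Proof. by []. Qed.

Lemma leq_search_task : {homo (fun m => (search m).1) : m m' / m <= m'}.
Proof.
by apply: homo_leq leqnn leq_trans _ => m; rewrite searchS /search_next; case: ifP.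
Qed.

Lemma search_failed m j : j < (search m).2 -> ~~ success (search m).1 j.
Proof.
elim: m j => // m IH j; rewrite searchS /search_next; case: ifP => //= /negbT no.
by rewrite ltnS leq_eqVlt => /orP[/eqP ->|/IH].
Qed.

Lemma search_success_after m j : success (search m).1 j ->
  exists2 i, m <= i & success (search i).1 (search i).2.
Proof.
move=> ok; have mj : (search m).2 <= j.
  by rewrite leqNgt; apply: contraTN ok; apply: search_failed.
apply: contrapT => never; suff stuck i : search (m + i) = ((search m).1, (search m).2 + i).
  by apply: never; exists (m + (j - (search m).2)); rewrite ?leq_addr // stuck subnKC.
elim: i => [|i IH]; first by rewrite !addn0 -surjective_pairing.
rewrite addnS searchS IH /search_next /= addnS; case: ifP => // ok'.
by case: never; exists (m + i); rewrite ?leq_addr // IH.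
Qed.

Lemma limsup_search :
  limsup (fun m => success (search m).1 (search m).2) <-> forall s, exists j, success s j.
Proof.
split=> [/limsupP inf s|all_s]; last first.
  by apply/limsupP => m; have [j] := all_s (search m).1; apply: search_success_after.
have [m sm] : exists m, s < (search m).1.
  elim: s => [|s [m sm]].
    by have [m _ ok] := inf 0; exists m.+1; rewrite searchS /search_next ok.
  have [i mi ok] := inf m; exists i.+1.
  by rewrite searchS /search_next ok ltnS (leq_trans sm) ?leq_search_task.
elim: m sm => // m IH; rewrite searchS /search_next; case: ifP => [ok|_ /IH //].
by rewrite ltnS leq_eqVlt => /orP[/eqP ->|/IH //]; exists (search m).2.
Qed.

End Search.

Definition next_pair (NM : nat * nat) : nat * nat :=
  if NM.1 is N'.+1 then (N', NM.2.+1) else (NM.2.+1, 0).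

Lemma iter_next_pair_onto (NM : nat * nat) : exists s, iter s next_pair (0, 0) = NM.
Proof.
case: NM => N M; move sum: (N + M) => d; elim: d M N sum => [|d IHd].
  by move=> M N; exists 0; have [-> ->] : N = 0 /\ M = 0 by lia.
elim=> [|M IHM] N sum.
  by have [s sE] := IHd d 0 erefl; exists s.+1; rewrite iterS sE /next_pair -sum addn0.
have [|s sE] := IHM N.+1; first by rewrite addSnnS.
by exists s.+1; rewrite iterS sE.
Qed.

Section PairSearch.
Variable success : nat * nat -> nat -> bool.
Local Notation task s := (iter s next_pair (0, 0)).

Definition pair_search (m : nat) : nat * nat * nat :=
  let: (s, j) := search (fun s => success (task s)) m in (task s, j).

Lemma pair_searchS m : pair_search m.+1 =
  let: (ij, k) := pair_search m in if success ij k then (next_pair ij, 0) else (ij, k.+1).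
Proof.
rewrite /pair_search searchS /search_next; case: (search _ m) => s j /=.
by case: (success _ j).
Qed.

Lemma limsup_pair_search :
  limsup (fun m => success (pair_search m).1 (pair_search m).2) <->
  forall ij, exists k, success ij k.
Proof.
rewrite /pair_search; under [X in limsup X]funext do rewrite [search _ _]surjective_pairing /=.
apply: (iff_trans (limsup_search (fun s => success (task s)))); split=> all_tasks => [ij|s //].
by have [s <-] := iter_next_pair_onto ij.
Qed.

End PairSearch.

(** * The verifier *)

Local Notation rGate := 4 (only parsing).
Local Notation rInput := 5 (only parsing).
Local Notation rTrial := 6 (only parsing).
Local Notation rCand := 7 (only parsing).
Local Notation rAddr1 := 8 (only parsing).
Local Notation rAddr2 := 9 (only parsing).
Local Notation rSum := 10 (only parsing).
Local Notation rHold := 11 (only parsing).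
Local Notation rCopy := 12 (only parsing).
Local Notation rResult := 13 (only parsing).
Local Notation rPos := 14 (only parsing).
Local Notation rAllowance := 15 (only parsing).
Local Notation rPhase := 16 (only parsing).
Local Notation rFuel := 17 (only parsing).
Local Notation rZero := 18 (only parsing).

Local Notation "c1 ;; c2" := (CSeq c1 c2) (at level 60, right associativity).

Definition clear_reg (a : nat) : cmd := CWhile a (CDec a).
Definition move_reg (a b : nat) : cmd := CWhile a (CDec a ;; CInc b).
Definition move_reg2 (a b c : nat) : cmd := CWhile a (CDec a ;; CInc b ;; CInc c).
Definition add_into (a b : nat) : cmd := move_reg2 a b rCopy ;; move_reg rCopy a.
Definition add_triangle (d : nat) : cmd :=
  CWhile rSum (CDec rSum ;; CInc d ;; move_reg2 rSum d rHold ;; move_reg rHold rSum).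
Definition pair_into (a b d : nat) : cmd :=
  add_into a rSum ;; add_into b rSum ;; add_into b d ;; add_triangle d.

Definition compare_bits : cmd :=
  CIf (TQuery 2 rAddr1)
    (CIf (TQuery 2 rAddr2)
       (CInc rPos ;; CIf (TZero rPhase) (CInc rAllowance) CSkip)
       (clear_reg rFuel))
    (CIf (TQuery 2 rAddr2)
       (CInc rResult ;; clear_reg rFuel)
       (CIf (TZero rAllowance) (clear_reg rFuel) (CDec rAllowance ;; CInc rPhase ;; CInc rPos))).

Definition compare_step : cmd :=
  CDec rFuel ;; pair_into rCand rPos rAddr1 ;; pair_into rGate rPos rAddr2 ;;
  compare_bits ;; clear_reg rAddr1 ;; clear_reg rAddr2.

Definition compare_rows : cmd :=
  add_into rCand rFuel ;; CWhile rFuel compare_step ;;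
  clear_reg rPos ;; clear_reg rAllowance ;; clear_reg rPhase.

Definition check_input : cmd :=
  CIf (TQuery 1 rCand)
    (pair_into rGate rCand rAddr1 ;;
     CIf (TQuery 0 rAddr1) (clear_reg rAddr1 ;; compare_rows) (clear_reg rAddr1))
    CSkip.

Definition next_task : cmd :=
  CFlash ;; clear_reg rTrial ;; CInc rInput ;;
  CIf (TZero rGate) (move_reg rInput rGate) (CDec rGate).

Definition verify_round : cmd :=
  CIf (TQuery 1 rGate) (add_into rInput rCand) (add_into rTrial rCand) ;;
  check_input ;; clear_reg rCand ;;
  CIf (TQuery 1 rGate)
    (CIf (TZero rResult) next_task (CInc rTrial))
    (CIf (TZero rResult) (CInc rTrial) next_task) ;;
  clear_reg rResult.

Definition verifier (b : bool) : cmd :=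
  if b then CIf (TQuery 1 rZero) verify_round CSkip else CIf (TQuery 1 rZero) CSkip verify_round.

Lemma verifier_ok (b : bool) : cmd_ok (verifier b).
Proof. by case: b. Qed.

Section Semantics.
Variable z : real.

Lemma exec_seq c1 c2 s1 s2 s3 f :
  exec z c1 s1 s2 false -> exec z c2 s2 s3 f -> exec z (c1 ;; c2) s1 s3 f.
Proof. exact: ExecSeq. Qed.

Lemma exec_while i c s1 s2 s3 : s1 i != 0 ->
  exec z c s1 s2 false -> exec z (CWhile i c) s2 s3 false -> exec z (CWhile i c) s1 s3 false.
Proof. exact: (@ExecWhileS _ _ _ _ _ _ false false). Qed.

Lemma exec_eq c s s1 s2 f : exec z c s s1 f -> s1 = s2 -> exec z c s s2 f.
Proof. by move=> run_c <-. Qed.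

Ltac eval_memory := rewrite /store; repeat (case: eqP => ? //=); subst; try lia.
Ltac memory_ext := apply: funext => ?; eval_memory.

Lemma exec_clear_reg a s : exec z (clear_reg a) s (store s a 0) false.
Proof.
move sa: (s a) => n; elim: n s sa => [|n IH] s sa.
  by apply: exec_eq (ExecWhile0 _ _ sa) _; rewrite -sa store_id.
apply: exec_while (ExecDec _ _ _) _; first by rewrite sa.
by apply: exec_eq (IH _ _) _; [rewrite /store eqxx sa|memory_ext].
Qed.

Lemma exec_move_reg a b s : a != b ->
  exec z (move_reg a b) s (store (store s b (s b + s a)) a 0) false.
Proof.
move=> ab; move sa: (s a) => n; elim: n s sa => [|n IH] s sa.
  by apply: exec_eq (ExecWhile0 _ _ sa) _; memory_ext.
apply: exec_while (exec_seq (ExecDec _ _ _) (ExecInc _ _ _)) _; first by rewrite sa.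
by apply: exec_eq (IH _ _) _; [rewrite /store eqxx (negPf ab) sa|memory_ext].
Qed.

Lemma exec_move_reg2 a b c s : a != b -> a != c -> b != c ->
  exec z (move_reg2 a b c) s (store (store (store s b (s b + s a)) c (s c + s a)) a 0) false.
Proof.
move=> ab ac bc; move sa: (s a) => n; elim: n s sa => [|n IH] s sa.
  by apply: exec_eq (ExecWhile0 _ _ sa) _; memory_ext.
apply: exec_while (exec_seq (ExecDec _ _ _) (exec_seq (ExecInc _ _ _) (ExecInc _ _ _))) _.
  by rewrite sa.
by apply: exec_eq (IH _ _) _; [rewrite /store eqxx (negPf ab) (negPf ac) sa|memory_ext].
Qed.

Lemma exec_add_into a b s : uniq [:: a; b; rCopy] -> s rCopy = 0 ->
  exec z (add_into a b) s (store s b (s b + s a)) false.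
Proof.
rewrite /= !inE negb_or andbT => /andP[/andP[ab ac] bc] s0.
apply: exec_seq; first exact: exec_move_reg2.
by apply: exec_eq; [apply: exec_move_reg; rewrite eq_sym|memory_ext].
Qed.

Lemma exec_add_triangle d s : uniq [:: d; rSum; rHold] -> s rHold = 0 ->
  exec z (add_triangle d) s (store (store s d (s d + 'C((s rSum).+1, 2))) rSum 0) false.
Proof.
rewrite /= !inE negb_or !andbT => /andP[d_sum d_hold].
move sum: (s rSum) => n; elim: n s sum => [|n IH] s sum s0.
  by apply: exec_eq (ExecWhile0 _ _ sum) _; rewrite bin_small //; memory_ext.
apply: exec_while; first by rewrite sum.
  apply: exec_seq (ExecDec _ _ _) _; apply: exec_seq (ExecInc _ _ _) _; apply: exec_seq.
    by apply: exec_move_reg2; rewrite // eq_sym.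
  exact: exec_move_reg.
by apply: exec_eq (IH _ _ _) _; rewrite ?bin2S; [eval_memory|eval_memory|memory_ext].
Qed.

Lemma exec_pair_into a b d s :
  uniq [:: a; d; rSum; rHold; rCopy] -> uniq [:: b; d; rSum; rHold; rCopy] ->
  s d = 0 -> s rSum = 0 -> s rHold = 0 -> s rCopy = 0 ->
  exec z (pair_into a b d) s (store s d (cantor_pair (s a) (s b))) false.
Proof.
rewrite /= !inE !negb_or !andbT => /andP[/and4P[ad a1 a2 a3] /and3P[d1 d2 d3]].
move=> /andP[/and4P[bd b1 b2 b3] _] s_d s_sum s_hold s_copy.
apply: exec_seq; first by apply: exec_add_into; rewrite //= !inE negb_or a1 a3.
apply: exec_seq; first by apply: exec_add_into; rewrite //= !inE negb_or b1 b3.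
apply: exec_seq.
  by apply: exec_add_into; rewrite //= ?inE ?negb_or ?bd ?b3 ?d3 //; eval_memory.
apply: exec_eq.
  by apply: exec_add_triangle; rewrite //= ?inE ?negb_or ?d1 ?d2 //; eval_memory.
by rewrite /cantor_pair; memory_ext; rewrite s_d s_sum !add0n addnC.
Qed.

Local Notation ranks := (fun a => z (block * a + 2)).
Local Notation wires := (fun a => z (block * a + 0)).
Local Notation value := (fun a => z (block * a + 1)).
Local Notation wire := (coded_wire wires ranks).
Local Notation solves := (nor_witness wire value).

Definition compare_memory (s : memory) (fuel pos allowance phase result : nat) : memory :=
  store (store (store (store (store s rFuel fuel) rPos pos) rAllowance allowance) rPhase phase)
    rResult result.

Definition compare_next (s : memory) (n t h ph : nat) (f0 g0 : bool) : memory :=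
  match f0, g0 with
  | true, true => compare_memory s n t.+1 (if ph != 0 then h else h.+1) ph 0
  | true, false => compare_memory s 0 t h ph 0
  | false, true => compare_memory s 0 t h ph 1
  | false, false =>
    if h is h'.+1 then compare_memory s n t.+1 h' ph.+1 0 else compare_memory s 0 t h ph 0
  end.

Lemma exec_compare_bits s n t h ph :
  exec z compare_bits (compare_memory s n t h ph 0)
    (compare_next s n t h ph (ranks (s rAddr1)) (ranks (s rAddr2))) false.
Proof.
have addr1E : compare_memory s n t h ph 0 rAddr1 = s rAddr1 by [].
have addr2E : compare_memory s n t h ph 0 rAddr2 = s rAddr2 by [].
apply: ExecIf; rewrite /= addr1E.
case: (z _); apply: ExecIf; rewrite /= addr2E; case: (z _) => /=.
- apply: exec_seq (ExecInc _ _ _) (ExecIf _); rewrite /=; case: eqP => ph0.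
    by apply: exec_eq (ExecInc _ _ _) _; rewrite /compare_memory; memory_ext.
  by apply: exec_eq (ExecSkip _ _) _; rewrite /compare_memory; memory_ext.
- by apply: exec_eq (exec_clear_reg _ _) _; rewrite /compare_memory; memory_ext.
- apply: exec_seq (ExecInc _ _ _) _.
  by apply: exec_eq (exec_clear_reg _ _) _; rewrite /compare_memory; memory_ext.
- apply: ExecIf; case: h {addr1E addr2E} => [|h] /=.
    by apply: exec_eq (exec_clear_reg _ _) _; rewrite /compare_memory; memory_ext.
  apply: exec_seq (ExecDec _ _ _) _; apply: exec_seq (ExecInc _ _ _) _.
  by apply: exec_eq (ExecInc _ _ _) _; rewrite /compare_memory; memory_ext.
Qed.

Definition round_memory (N M J Q R : nat) : memory :=
  store (store (store (store (store (fun=> 0) rGate N) rInput M) rTrial J) rCand Q) rResult R.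

Section Round.
Variables N M J : nat.
Local Notation mem := (round_memory N M J).

Lemma exec_compare_step Q n t h ph :
  exec z compare_step (compare_memory (mem Q 0) n.+1 t h ph 0)
    (compare_next (mem Q 0) n t h ph (row ranks Q t) (row ranks N t)) false.
Proof.
apply: exec_seq (ExecDec _ _ _) _.
apply: exec_seq; first exact: exec_pair_into.
apply: exec_seq; first exact: exec_pair_into.
set m := (X in exec _ _ X _ _).
pose s := store (store (mem Q 0) rAddr1 (cantor_pair Q t)) rAddr2 (cantor_pair N t).
have {m}-> : m = compare_memory s n t h ph 0.
  by rewrite /m /s /compare_memory /round_memory; memory_ext.
have bits : exec z compare_bits (compare_memory s n t h ph 0)
    (compare_next s n t h ph (row ranks Q t) (row ranks N t)) false.
  exact: exec_compare_bits.
apply: exec_seq bits _; apply: exec_seq (exec_clear_reg _ _) _.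
apply: exec_eq (exec_clear_reg _ _) _.
rewrite /compare_next; case: (row _ _ _); case: (row _ _ _); case: h => [|h];
by rewrite /s /compare_memory /round_memory; memory_ext.
Qed.

Lemma exec_compare_loop Q n t h ph : exists t' h' ph',
  exec z (CWhile rFuel compare_step) (compare_memory (mem Q 0) n t h ph 0)
    (compare_memory (mem Q 0) 0 t' h' ph'
       (row_lt n (drop_row t (row ranks Q)) (drop_row t (row ranks N)) h (ph != 0))) false.
Proof.
elim: n t h ph => [|n IH] t h ph; first by exists t, h, ph; apply: ExecWhile0.
have enter s s' : exec z compare_step (compare_memory (mem Q 0) n.+1 t h ph 0) s false ->
    exec z (CWhile rFuel compare_step) s s' false ->
    exec z (CWhile rFuel compare_step) (compare_memory (mem Q 0) n.+1 t h ph 0) s' false.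
  exact: exec_while.
move: (exec_compare_step Q n t h ph); rewrite /compare_next /= -!drop_rowS /drop_row !addn0.
case: (row ranks Q t); case: (row ranks N t) => /enter next.
- have [t' [h' [ph' loop]]] := IH t.+1 (if ph != 0 then h else h.+1) ph.
  by exists t', h', ph'; apply: next loop.
- by exists t, h, ph; apply/next/ExecWhile0.
- by exists t, h, ph; apply/next/ExecWhile0.
- case: h {enter} next => [|h] next; first by exists t, 0, ph; apply/next/ExecWhile0.
  have [t' [h' [ph' loop]]] := IH t.+1 h ph.+1.
  by exists t', h', ph'; apply: next loop.
Qed.

Lemma exec_compare_rows Q :
  exec z compare_rows (mem Q 0) (mem Q (descends ranks N Q)) false.
Proof.
apply: exec_seq; first exact: exec_add_into.
have [t [h [ph loop]]] := exec_compare_loop Q Q 0 0 0.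
rewrite [X in exec _ _ X _ _](_ : _ = compare_memory (mem Q 0) Q 0 0 0 0); last first.
  by rewrite /compare_memory /round_memory; memory_ext.
apply: exec_seq loop _; do 2 apply: exec_seq (exec_clear_reg _ _) _.
by apply: exec_eq (exec_clear_reg _ _) _; rewrite /compare_memory /round_memory; memory_ext.
Qed.

Lemma exec_check_input Q :
  exec z check_input (mem Q 0) (mem Q (true_input wire value N Q)) false.
Proof.
have valueE : holds z (TQuery 1 rCand) (mem Q 0) = value Q by [].
apply: ExecIf; rewrite valueE /true_input /coded_wire; case: (z _) => /=; last exact: ExecSkip.
apply: exec_seq; first exact: exec_pair_into.
set m := store _ _ _; have m_addr : store m rAddr1 0 = mem Q 0.
  by rewrite /m /round_memory; memory_ext.
have wireE : holds z (TQuery 0 rAddr1) m = wires (cantor_pair N Q) by [].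
apply: ExecIf; rewrite wireE; case: (z _) => /=; last by apply: exec_eq (exec_clear_reg _ _) _.
by apply: exec_seq (exec_clear_reg _ _) _; rewrite m_addr; apply: exec_compare_rows.
Qed.

End Round.

Lemma exec_next_task N M J R :
  exec z next_task (round_memory N M J 0 R)
    (round_memory (next_pair (N, M)).1 (next_pair (N, M)).2 0 0 R) true.
Proof.
rewrite -[true]/(true || false); apply: ExecSeq (ExecFlash _ _) _.
apply: exec_seq (exec_clear_reg _ _) _; apply: exec_seq (ExecInc _ _ _) _.
apply: ExecIf; case: N => [|N] /=.
  by apply: exec_eq (exec_move_reg _ _) _; rewrite // /round_memory; memory_ext.
by apply: exec_eq (ExecDec _ _ _) _; rewrite /round_memory; memory_ext.
Qed.

Definition memory_of (NMJ : nat * nat * nat) : memory :=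
  round_memory NMJ.1.1 NMJ.1.2 NMJ.2 0 0.

Lemma exec_round NM J :
  exec z verify_round (memory_of (NM, J))
    (memory_of (if solves NM J then (next_pair NM, 0) else (NM, J.+1))) (solves NM J).
Proof.
case: NM => N M; set ok := solves _ _; set Q := if value N then M else J.
have valueE Q' R : holds z (TQuery 1 rGate) (round_memory N M J Q' R) = value N by [].
apply: (exec_seq (s2 := round_memory N M J Q 0)).
  apply: ExecIf; rewrite valueE /Q; case: (z _);
  by apply: exec_eq (exec_add_into _ _) _; rewrite // /memory_of /round_memory; memory_ext.
apply: exec_seq (exec_check_input _ _ _ _) _; apply: exec_seq (exec_clear_reg _ _) _.
set m := (X in exec _ _ X _ _).
have {m}-> : m = round_memory N M J 0 (true_input wire value N Q).
  by rewrite /m /round_memory; memory_ext.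
set next := if ok then _ else _.
pose s := round_memory next.1.1 next.1.2 next.2 0 (true_input wire value N Q).
rewrite -[ok]orbF; apply: (ExecSeq (s2 := s)); last first.
  by apply: exec_eq (exec_clear_reg _ _) _; rewrite /s /memory_of /round_memory; memory_ext.
have zeroE R : holds z (TZero rResult) (round_memory N M J 0 R) = (R == 0) by [].
have retry R : exec z (CInc rTrial) (round_memory N M J 0 R) (round_memory N M J.+1 0 R) false.
  by apply: exec_eq (ExecInc _ _ _) _; rewrite /round_memory; memory_ext.
rewrite /s /next /ok /nor_witness -/Q /=; apply: ExecIf; rewrite valueE.
case: (z _); apply: ExecIf; rewrite zeroE; case: (true_input wire value N Q) => /=;
by [apply: retry|apply: exec_next_task].
Qed.

Lemma exec_verifier b NM J : value 0 = b ->
  exec z (verifier b) (memory_of (NM, J))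
    (memory_of (if solves NM J then (next_pair NM, 0) else (NM, J.+1))) (solves NM J).
Proof.
have zeroE : holds z (TQuery 1 rZero) (memory_of (NM, J)) = value 0 by [].
by rewrite /verifier => <-; case v0: (z _); apply: ExecIf; rewrite zeroE v0; apply: exec_round.
Qed.

Lemma exec_verifier_reject b : value 0 != b -> exec z (verifier b) (fun=> 0) (fun=> 0) false.
Proof.
have zeroE : holds z (TQuery 1 rZero) (fun=> 0) = value 0 by [].
by case: b => /=; case v0: (z _) => // _; apply: ExecIf; rewrite zeroE v0; apply: ExecSkip.
Qed.

Lemma HaltsWith_verifier b : exists v, HaltsWith (loop_machine (verifier b)) 2 z v /\
  (v <-> value 0 = b /\ nor_valuation wire value).
Proof.
have [v0|v0] := eqVneq (z (block * 0 + 1)) b; last first.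
  exists (limsup (fun=> false)); split; last by split=> [/limsupP/(_ 0)[]|[]] //; move/eqP: v0.
  apply: (HaltsWith_loop (s := fun _ _ => 0)) (verifier_ok b) _ _ => // _.
  exact: exec_verifier_reject.
pose task := pair_search solves.
exists (limsup (fun m => solves (task m).1 (task m).2)); split.
  apply: (HaltsWith_loop (s := memory_of \o task)) (verifier_ok b) _ _ => [|m] /=.
    by rewrite /memory_of /round_memory; memory_ext.
  by rewrite /task pair_searchS; case: (pair_search _ m) => NM J; apply: exec_verifier.
apply: (iff_trans (limsup_pair_search _)); apply: (iff_trans (nor_witnessP _ _)).
by split=> [|[]].
Qed.

End Semantics.

Lemma pairR_double (x y : real) (k : nat) : pairR x y k.*2 = x k.
Proof. by rewrite /pairR odd_double doubleK. Qed.

Lemma pairR_doubleS (x y : real) (k : nat) : pairR x y k.*2.+1 = y k.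
Proof. by rewrite /pairR /= odd_double uphalf_double. Qed.

Lemma outputs_NP (b : bool) : inNP (outputs b).
Proof.
have verify x y : exists v, HaltsWith (loop_machine (verifier b)) 2 (pairR x y) v /\
    (v <-> y 0 = b /\ nor_valuation (circuit x) (fun a => y (10 * a))).
  have [v [halts vE]] := HaltsWith_verifier (pairR x y) b; exists v; split=> //.
  have wireE a : pairR x y (block * a + 0) = x (10 * a).
    by rewrite -(pairR_double x y); congr pairR; lia.
  have labelE a : pairR x y (block * a + 2) = x (10 * a + 1).
    by rewrite -(pairR_double x y); congr pairR; lia.
  have valueE a : pairR x y (block * a + 1) = y (10 * a).
    by rewrite -(pairR_doubleS x y); congr pairR; lia.
  by rewrite vE valueE (funext wireE) (funext labelE) (funext valueE).
exists (loop_machine (verifier b)), 2; split=> [x y|x].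
  by have [v [halts _]] := verify x y; exists v.
split=> [[v nor_v v0]|[y accepts]].
  pose y k := v (k %/ 10); exists y; have [a [halts aE]] := verify x y.
  have <- // : a = true; apply/aE; split=> //.
  by rewrite /y (_ : (fun a => _) = v) //; apply: funext => a'; rewrite mulKn.
have [a [halts aE]] := verify x y.
by have /aE[y0 nor_y] := HaltsWith_unique halts accepts; exists (fun a => y (10 * a)).
Qed.

Lemma outputs_coNP : incoNP (outputs true).
Proof. by exists (outputs false); split; [apply: outputs_NP|apply: outputs_trueP]. Qed.

(** * Ranks coded by rows of bits *)

Definition shortlex (s t : seq nat) : bool :=
  (size s < size t) || (size s == size t) && lexlt s t.

Fixpoint unary (s : seq nat) : seq bool :=
  if s is a :: s' then nseq a true ++ false :: unary s' else [::].

(* The leading block of ones announces the length of [s]: it is the allowance of [row_lt]. *)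
Definition rank_row (s : seq nat) : seq bool := unary (size s :: s).

Lemma row_lt_unary_tail (s t : seq nat) (fuel h : nat) :
  size s = size t -> size s <= h.+1 -> lexlt s t -> size (unary s) <= fuel ->
  row_lt fuel (nth false (unary s)) (nth false (unary t)) h true.
Proof.
elim: s t fuel h => [|a s IH] [|b t] //= fuel h [st]; rewrite ltnS => sh.
elim: a b fuel => [|a IHa] [|b] [|fuel] //=; last exact: IHa.
rewrite ltnS; case: h sh => [|h] sh; last exact: IH.
by case: s st sh {IH} => [|? ?] //; case: t.
Qed.

Lemma row_lt_unary (a b : nat) (s t : seq nat) (fuel h : nat) :
  lexlt (a :: s) (b :: t) -> (a = b -> size s = size t) -> size s <= h + a ->
  size (unary (a :: s)) <= fuel ->
  row_lt fuel (nth false (unary (a :: s))) (nth false (unary (b :: t))) h false.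
Proof.
elim: a b fuel h => [|a IHa] [|b] [|fuel] h //=.
  rewrite addn0 => st /(_ erefl) sizes sh; rewrite ltnS => le_fuel.
  case: h sh => [|h] sh; last exact: row_lt_unary_tail.
  by case: s st sizes sh {le_fuel} => [|? ?] //; case: t.
move=> lt_st sizes sh le_fuel; apply: IHa => //; last by rewrite addSnnS.
by move=> ab; apply: sizes; rewrite ab.
Qed.

Lemma row_lt_rank_row (s t : seq nat) (fuel : nat) : shortlex s t -> size (rank_row s) <= fuel ->
  row_lt fuel (nth false (rank_row s)) (nth false (rank_row t)) 0 false.
Proof. by move=> lt_st; apply: row_lt_unary. Qed.

(** * The circuit of a run *)

Section Gates.
Variables (p : Prog) (n : nat).
Local Notation stage := (n.-tuple nat).

Definition literal := (St p + nat + nat * nat)%type.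
Definition lit_state (q : St p) : literal := inl (inl q).
Definition lit_head (h : nat) : literal := inl (inr h).
Definition lit_tape (i k : nat) : literal := inr (i, k).
Definition is_tape_lit (l : literal) : bool := if l is inr _ then true else false.

Definition lit_value (c : Config p) (l : literal) : bool :=
  match l with
  | inl (inl q) => cst c == q
  | inl (inr h) => chead c == h
  | inr (i, k) => tape c i k
  end.

Definition view := (St p * nat * (bool * bool * bool))%type.

Definition view_of (c : Config p) : view :=
  let h := chead c in (cst c, h, (tape1 c h, tape2 c h, tape3 c h)).

Definition next_value (w : view) (l : literal) (b : bool) : bool :=
  let: (q, h, bits) := w in
  if q == halt_st p then b else
  let: (q', (w1, w2, w3), mv) := delta q bits in
  match l with
  | inl (inl q'') => q' == q''
  | inl (inr h') => (if mv then h.+1 else h.-1) == h'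
  | inr (i, k) => if k == h then match i with 0 => w1 | 1 => w2 | _ => w3 end else b
  end.

Lemma lit_value_step c l : lit_value (step c) l = next_value (view_of c) l (lit_value c l).
Proof.
rewrite /next_value /view_of /step; case: ifP => // _.
by case: (delta _ _) => [[q' [[w1 w2] w3]] mv]; case: l => [[q|h]|[[|[|i]] k]].
Qed.

Definition tests (w : view) (l : literal) (b : bool) : seq (literal * bool) :=
  let: (q, h, (b1, b2, b3)) := w in
  [:: (lit_state q, true); (lit_head h, true); (lit_tape 0 h, b1); (lit_tape 1 h, b2);
      (lit_tape 2 h, b3); (l, b)].

Lemma all_tests c w l b :
  all (fun t => lit_value c t.1 == t.2) (tests w l b) = (view_of c == w) && (lit_value c l == b).
Proof.
case: w => [[q h] [[b1 b2] b3]]; rewrite /= /view_of !xpair_eqE !eqb_id !andbT.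
by case: (chead c =P h) => [->|_]; rewrite ?andbF // !andbA andbT.
Qed.

(* [Match a w l b]: at stage [a] the view is [w] and [l] has value [b];
   [FalseFrom b a l]: [l] is false from stage [b] on, before stage [a]. *)
Inductive gate :=
| Root
| One
| Accept of stage
| Match of stage & view & literal & bool
| Lit of stage & literal
| NotLit of stage & literal
| Limsup of stage & literal
| FalseFrom of stage & stage & literal.

Definition succ_stage (b a : stage) : bool :=
  [&& ~~ is_zero a, ~~ is_limit a, lexlt b a & a == incr_last b :> seq nat].

Definition halted : literal := lit_state (halt_st p).

Definition wire (e : real) (x y : gate) : bool :=
  match x, y with
  | Root, Accept _ => true
  | Accept a, NotLit a' l => (a' == a) && (l \in [:: halted; lit_tape 2 0])
  | Accept a, Lit b l => lexlt b a && (l == halted)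
  | Match a w l b, Lit a' l' => (a' == a) && ((l', false) \in tests w l b)
  | Match a w l b, NotLit a' l' => (a' == a) && ((l', true) \in tests w l b)
  | Lit a l, NotLit a' l' => (a' == a) && (l' == l)
  | NotLit a l, One =>
    is_zero a && lit_value (init p e) l ||
    is_limit a && (l \in [:: lit_state (limit_st p); lit_head 0])
  | NotLit a l, Match b w l' c => [&& succ_stage b a, l' == l & next_value w l c]
  | NotLit a l, Limsup a' l' => [&& is_limit a, a' == a, is_tape_lit l & l' == l]
  | Limsup a l, FalseFrom b a' l' => [&& lexlt b a, a' == a & l' == l]
  | FalseFrom b a l, Lit g l' => [&& lexle b g, lexlt g a & l' == l]
  | _, _ => false
  end.

Definition rank (x : gate) : seq nat :=
  match x with
  | Root => nseq n.+2 0
  | One => [::]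
  | Accept a => rcons a 5
  | Match a _ _ _ => rcons a 4
  | Lit a _ => rcons a 3
  | NotLit a _ => rcons a 2
  | Limsup a _ => rcons a 1
  | FalseFrom _ a _ => rcons a 0
  end.

Lemma wire_shortlex e x y : wire e x y -> shortlex (rank y) (rank x).
Proof.
have same (a a' : stage) i j : a' == a -> i < j -> shortlex (rcons a' i) (rcons a j).
  by move=> /eqP -> ij; rewrite /shortlex !size_rcons lexlt_rcons // !eqxx ij !orbT.
have earlier (a b : stage) i j : lexlt b a -> shortlex (rcons b i) (rcons a j).
  by move=> ba; rewrite /shortlex !size_rcons lexlt_rcons ?size_tuple // ba eqxx orbT.
case: x => >; case: y => > //=.
- by rewrite /shortlex size_rcons /= size_nseq size_tuple ltnSn.
- by case/andP=> ba _; apply: earlier.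
- by case/andP=> a'a _; apply: same.
- by case/andP=> a'a _; apply: same.
- by case/andP=> a'a _; apply: same.
- by case/andP=> a'a _; apply: same.
- by rewrite /shortlex size_rcons.
- by case/and3P=> /and4P[_ _ ba _] _ _; apply: earlier.
- by case/and4P=> _ a'a _ _; apply: same.
- by case/and3P=> _ a'a _; apply: same.
- by case/and3P=> _ ga _; apply: earlier.
Qed.

Section Values.
Variables (e : real) (V : gate -> bool) (r : seq nat -> Config p).
Hypotheses (nor_V : nor_valuation (wire e) V) (R : run p e n r).
Implicit Types (a b : stage) (l : literal).

Lemma valuation_One : V One.
Proof. by apply/nor_V => -[]. Qed.

Lemma valuation_Lit a l : V (Lit a l) = ~~ V (NotLit a l).
Proof.
apply/idP/idP => [/nor_V|VN]; first by apply; rewrite /= !eqxx.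
by apply/nor_V => -[] // a' l' /= /andP[/eqP -> /eqP ->].
Qed.

Definition evaluates a : Prop := forall l, V (NotLit a l) = ~~ lit_value (r a) l.

Definition evaluates_before a : Prop := forall b, lexlt b a -> evaluates b.

Lemma valuation_Lit_value a l : evaluates a -> V (Lit a l) = lit_value (r a) l.
Proof. by move=> ev; rewrite valuation_Lit ev negbK. Qed.

Lemma valuation_Match a w l (c : bool) : evaluates a ->
  V (Match a w l c) = (view_of (r a) == w) && (lit_value (r a) l == c).
Proof.
move=> ev; rewrite -all_tests; apply/idP/allP => [VM [l' [] in_tests] /=|ok].
- rewrite eqb_id -valuation_Lit_value // valuation_Lit.
  by apply: (nor_V _).1 VM _ _; rewrite /= eqxx.
- rewrite eqbF_neg -ev; have := (nor_V _).1 VM (Lit a l').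
  by rewrite /= eqxx valuation_Lit negbK; apply.
apply/nor_V => -[] //= a' l' /andP[/eqP -> /ok /= /eqP l'E].
  by rewrite valuation_Lit_value // l'E.
by rewrite ev l'E.
Qed.

Lemma valuation_FalseFrom b a l : evaluates_before a ->
  V (FalseFrom b a l) <-> forall g : stage, lexle b g -> lexlt g a -> ~~ lit_value (r g) l.
Proof.
move=> ev; apply: (iff_trans (nor_V _)); split=> [no_lit g bg ga|no_lit [] // g l' /=].
  by rewrite -valuation_Lit_value ?ev //; [apply: no_lit; rewrite /= bg ga eqxx|apply: ev].
by case/and3P=> bg ga /eqP ->; rewrite valuation_Lit_value; [apply: no_lit|apply: ev].
Qed.

Lemma valuation_Limsup a l : evaluates_before a ->
  V (Limsup a l) <-> limsup_before n (fun g => lit_value (r g) l) a.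
Proof.
move=> ev; rewrite limsup_beforeP; apply: (iff_trans (nor_V _)); split=> [sup b ba|sup].
  have : ~~ V (FalseFrom b a l) by apply: sup; rewrite /= ba !eqxx.
  apply: contraNP => no_g; apply/valuation_FalseFrom => // g bg ga; apply/negP => lg.
  by apply: no_g; exists g.
case=> // b a' l' /= /and3P[ba /eqP -> /eqP ->]; apply/negP => /valuation_FalseFrom no_lit.
by have [g [bg ga]] := sup b ba; apply/negP/no_lit.
Qed.

Lemma evaluates_zero a : is_zero a -> evaluates a.
Proof.
move=> a0 l; have not_lim : is_limit a = false by rewrite /is_limit a0.
have -> : r a = init p e by have [r0 _ _] := R; rewrite r0 ?size_tuple.
case lE: (lit_value _ l).
  by apply: nor_valuation_false nor_V _ valuation_One; rewrite /= a0 lE.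
by apply/nor_V => -[] > //=; rewrite ?lE /succ_stage ?a0 ?not_lim ?andbF.
Qed.

Lemma evaluates_succ a : ~~ is_zero a -> ~~ is_limit a -> evaluates_before a ->
  evaluates a.
Proof.
move=> a_neq0 not_lim ev l.
have raE b : succ_stage b a ->
    lit_value (r a) l = next_value (view_of (r b)) l (lit_value (r b) l).
  by move=> /and4P[_ _ ba /eqP aE]; rewrite (run_incr_last R ba aE) lit_value_step.
case lE: (lit_value (r a) l).
  have [b ab] : exists b, succ_stage b a.
    case: (stageP a) (a_neq0) (not_lim) => // b aE ba _ _; exists b.
    by rewrite /succ_stage a_neq0 not_lim ba aE eqxx.
  apply: (nor_valuation_false (y := Match b (view_of (r b)) l (lit_value (r b) l)) nor_V).
    by rewrite /wire ab eqxx -raE.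
  by rewrite valuation_Match ?eqxx //; apply: ev; case/and4P: ab.
apply/nor_V => -[] //=; rewrite ?(negPf a_neq0) ?(negPf not_lim) // => b w l' c.
case/and3P=> ab /eqP -> next; rewrite valuation_Match; last by apply: ev; case/and4P: ab.
by apply/negP => /andP[/eqP wE /eqP cE]; move: next; rewrite -wE -cE -raE // lE.
Qed.

Lemma valuation_NotLit_limit a l : is_limit a ->
  V (NotLit a l) =
    ~~ ((l \in [:: lit_state (limit_st p); lit_head 0]) || is_tape_lit l && V (Limsup a l)).
Proof.
move=> a_lim; have a_neq0 : is_zero a = false by apply/negbTE; case/andP: a_lim.
apply/idP/norP => [VN|[not_fixed not_sup]].
  split.
    apply: contraTN valuation_One => fixed; apply: (nor_V _).1 VN _ _.
    by rewrite /= a_lim fixed orbT.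
  have [tape_l|] := boolP (is_tape_lit l) => //=.
  by apply: (nor_V _).1 VN _ _; rewrite /= a_lim tape_l !eqxx.
apply/nor_V => -[] > //=.
- by rewrite a_neq0 a_lim (negPf not_fixed).
- by rewrite /succ_stage a_lim andbF.
- by case/and4P=> _ /eqP -> tape_l /eqP ->; move: not_sup; rewrite tape_l.
Qed.

Lemma evaluates_limit a : is_limit a -> evaluates_before a -> evaluates a.
Proof.
move=> a_lim ev l; have [q h tE] := run_limit R a_lim.
rewrite valuation_NotLit_limit //; congr (~~ _).
case: l => [[q'|h']|[i k]]; rewrite !inE /=.
- by rewrite !orbF q eq_sym.
- by rewrite orbF h eq_sym.
- by apply/idP/idP => [/(valuation_Limsup _ ev)/tE|/tE/(valuation_Limsup (lit_tape i k) ev)].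
Qed.

Lemma valuation_NotLit a : evaluates a.
Proof.
elim/(well_founded_ind (lexlt_wf (n := n))) : a => a IH.
have [a0|a_neq0] := boolP (is_zero a); first exact: evaluates_zero.
have [a_lim|not_lim] := boolP (is_limit a); first exact: evaluates_limit.
exact: evaluates_succ.
Qed.

Lemma valuation_Accept a : V (Accept a) <-> halts_at r a /\ tape3 (r a) 0.
Proof.
apply: (iff_trans (nor_V _)); split=> [acc|[[a_halt first] out]].
  have lit_true l : l \in [:: halted; lit_tape 2 0] -> lit_value (r a) l.
    by move=> l_in; rewrite -[lit_value _ _]negbK -valuation_NotLit; apply: acc; rewrite /= eqxx.
  split; last by apply: (lit_true (lit_tape 2 0)); rewrite !inE eqxx orbT.
  split=> [|g ga]; first by apply/eqP/(lit_true halted); rewrite mem_head.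
  apply/eqP; rewrite -[_ == _]/(lit_value (r g) halted) -valuation_Lit_value.
    by apply: acc; rewrite /= ga eqxx.
  exact: valuation_NotLit.
case=> //= g l.
  case/andP=> ga /eqP ->; rewrite valuation_Lit_value; first exact/eqP/first.
  exact: valuation_NotLit.
case/andP=> /eqP -> l_in; rewrite valuation_NotLit negbK.
by move: l_in; rewrite !inE => /orP[]/eqP -> //=; apply/eqP.
Qed.

Lemma valuation_Root (v : bool) : HaltsWith p n e v -> V Root = ~~ v.
Proof.
move=> halts; have RootE : V Root <-> ~ HaltsWith p n e true.
  apply: (iff_trans (nor_V _)); split=> [no_acc|no_acc [] //= a _].
    case/(HaltsWithP _ R)=> a a_halt out.
    by have /negP := no_acc (Accept a) isT; apply; apply/valuation_Accept.
  by apply/negP => /valuation_Accept[a_halt out]; apply/no_acc/(HaltsWithP _ R); exists a.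
case: v halts => /= halts; first by apply/negP => /RootE.
by apply/RootE => /(HaltsWith_unique halts).
Qed.

End Values.

(** * The circuit of a run on its own code *)

Definition gate_code (x : gate) : nat :=
  pickle (match x with
  | Root => (0, 0)
  | One => (1, 0)
  | Accept a => (2, pickle a)
  | Match a w l b => (3, pickle (a, w, l, b))
  | Lit a l => (4, pickle (a, l))
  | NotLit a l => (5, pickle (a, l))
  | Limsup a l => (6, pickle (a, l))
  | FalseFrom b a l => (7, pickle (b, a, l))
  end).

Lemma gate_code_inj : injective gate_code.
Proof.
move=> x y /(pcan_inj pickleK).
by case: x => >; case: y => > // [/(pcan_inj pickleK)] ?; congruence.
Qed.

(* The weight makes the number of a gate exceed both the length of its row,
   which bounds the fuel of [row_lt], and the index of an input bit that the
   wires of the gate depend on. *)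
Definition gate_weight (x : gate) : nat :=
  size (rank_row (rank x)) + if x is NotLit _ (inr (_, k)) then k else 0.

Definition gate_num (x : gate) : nat :=
  if x is Root then 0 else (cantor_pair (gate_code x) (gate_weight x)).+1.

Lemma gate_num_inj : injective gate_num.
Proof.
by move=> x y; case: x => >; case: y => > // [/cantor_pair_inj[/gate_code_inj]].
Qed.

Lemma wire_causal e e' x y : (forall j, j < gate_num x -> e j = e' j) -> wire e x y = wire e' x y.
Proof.
case: x => // a l ee'; case: y => //=; case: l ee' => [[q|h]|[[|i] k]] //= ee'.
rewrite ee' // ltnS; apply: leq_trans (leq_cantor_pairr _ _); exact: leq_addl.
Qed.

(* A fixed point codes the circuit of the run on its own code. *)
Definition describe (e : real) : real := fun k =>
  `[< exists x y, k = 10 * cantor_pair (gate_num x) (gate_num y) /\ wire e x y >] ||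
  `[< exists x t, k = 10 * cantor_pair (gate_num x) t + 1 /\ nth false (rank_row (rank x)) t >].

Lemma describe_causal e e' k : (forall j, j < k -> e j = e' j) -> describe e k = describe e' k.
Proof.
move=> ee'; rewrite /describe; congr (asbool _ || _).
apply: eq_exists => x; apply: eq_exists => y; apply/propeqP.
by split=> -[kE xy]; split=> //; move: xy; rewrite (@wire_causal e e') // => j jx; apply: ee';
  have := leq_cantor_pairl (gate_num x) (gate_num y); lia.
Qed.

Section SelfDescription.
Variables (e : real) (e_fix : forall k, e k = describe e k).

Lemma row_gate x : row (fun a => e (10 * a + 1)) (gate_num x) = nth false (rank_row (rank x)).
Proof.
apply: funext => t; rewrite /row e_fix; apply/idP/idP => [|xt].
  case/orP=> /asboolP[x' [t' [tE x't]]]; first by lia.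
  by have /cantor_pair_inj[/gate_num_inj -> ->] :
    cantor_pair (gate_num x) t = cantor_pair (gate_num x') t' by lia.
by apply/orP; right; apply/asboolP; exists x, t.
Qed.

Lemma circuit_gate x M : circuit e (gate_num x) M <-> exists2 y, M = gate_num y & wire e x y.
Proof.
split=> [/andP[+ _]|[y -> xy]].
  rewrite e_fix => /orP[]/asboolP[x' [y [E x'y]]]; last by lia.
  have /cantor_pair_inj[/gate_num_inj -> ->] :
    cantor_pair (gate_num x) M = cantor_pair (gate_num x') (gate_num y) by lia.
  by exists y.
apply/andP; split; first by rewrite e_fix; apply/orP; left; apply/asboolP; exists x, y.
rewrite /descends !row_gate; apply: row_lt_rank_row; first exact: wire_shortlex xy.
have -> : gate_num y = (cantor_pair (gate_code y) (gate_weight y)).+1 by case: y x xy => // -[].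
by apply/leqW/(leq_trans _ (leq_cantor_pairr _ _))/leq_addr.
Qed.

End SelfDescription.
End Gates.

Lemma diagonal_circuit_exists (p : Prog) (n : nat) :
  exists e, forall v, HaltsWith p n e v -> outputs (~~ v) e.
Proof.
have [e e_fix] := causal_fixpoint false (@describe_causal p n); exists e => v halts.
have wf : well_founded (fun M N => circuit e N M) by apply: coded_wire_wf.
have [w nor_w] := nor_valuation_exists wf; exists w => //; have [r [R _]] := halts.
exact: valuation_Root (nor_valuation_comp (circuit_gate e_fix) nor_w) R _ halts.
Qed.

Lemma outputs_notP : ~ inP (outputs true).
Proof.
move=> [p [n decides]]; have [e rejects] := diagonal_circuit_exists p n.
have [v [/rejects out vE]] := decides e; case: v out vE => /= out vE.
  by case/outputs_trueP: (vE.1 erefl).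
by have := vE.2 out.
Qed.

Theorem mainTheorem4 :
  ~ (forall A : real -> Prop, inP A <-> (inNP A /\ incoNP A)) /\
  ~ (forall A : real -> Prop, inP A <-> inNP A).
Proof.
split=> collapse; apply: outputs_notP; apply/collapse; last exact: outputs_NP.
by split; [apply: outputs_NP|apply: outputs_coNP].
Qed.
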